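(* Let $G$ be a non-elementary group admitting a proper action by isometries with purely exponential growth on a proper geodesic metric space $(X,d)$ such that $G$ contains a contracting element. Let $H\subset G$ be a nontrivial confined subgroup with a finite non-degenerate confining subset. Then $H$ has negligible quotient growth, i.e. $$\frac{|B_{G/H}(n)|}{|B(n)|}\longrightarrow 0\quad\text{as } n\to\infty .$$
   Context: $G$ is a discrete group; non-elementary means neither finite nor virtually $\mathbb Z$. Fix a base point $o\in X$. Contracting elements: for closed $Z\subseteq X$ let $\pi_Z(x)=\{y\in Z: d(x,y)=d(x,Z)\}$. $Z$ is $C$-contracting ($C>0$) if for all $x,y\in X$, $d(x,y)\le d(x,Z)$ implies $\mathrm{diam}(\pi_Z(x)\cup\pi_Z(y))\le C$. An element $h\in G$ is contracting if $n\in\mathbb Z\mapsto h^n o$ is a quasi-geodesic whose image is $C$-contracting for some $C$. $E(G)$ denotes the maximal finite normal subgroup of $G$ (it exists in this setting). A subset $P\subseteq G$ is non-degenerate if it is nonempty and $P\cap E(G)=\emptyset$. A nontrivial subgroup $H\le G$ is confined, with confining subset a finite set $P\subset G$, if $g^{-1}Hg\cap(P\setminus\{1\})\ne\emptyset$ for every $g\in G$. $B(n)=\{g\in G: d(o,go)\le n\}$, $\omega_G=\limsup_{n\to\infty} n^{-1}\ln|B(n)|$, assumed finite; $B_{G/H}(n)=\{gH: d(o,gHo)\le n\}$. The action has purely exponential growth if there is a constant $c\ge1$ with $c^{-1}e^{n\omega_G}\le|B(n)|\le c\,e^{n\omega_G}$ for all $n\ge1$. *)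

(* Defs.v *)
From HB Require Import structures.
From mathcomp Require Import all_boot all_order all_algebra finmap.
From mathcomp Require Import all_classical all_reals all_analysis.

Set Implicit Arguments.
Unset Strict Implicit.
Unset Printing Implicit Defensive.

Import Order.TTheory GRing.Theory Num.Theory.
Import numFieldNormedType.Exports.

Local Open Scope classical_set_scope.
Local Open Scope ring_scope.

Definition is_subgroup (G : groupType) (H : set G) : Prop := group_closed (mem H).

Definition left_coset (G : groupType) (H : set G) (g : G) : set G :=
  [set (g * h)%g | h in H].

(* [(h ^ g)%g] is [g^-1 * (h * g)]. *)
Definition conj_set (G : groupType) (H : set G) (g : G) : set G :=
  [set (h ^ g)%g | h in H].

Definition expgz (G : groupType) (h : G) (n : int) : G :=
  match n with
  | Posz k => (h ^+ k)%g
  | Negz k => (h ^- k.+1)%g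
  end.

Definition finite_index (G : groupType) (K : set G) : Prop :=
  finite_set [set left_coset K g | g in [set: G]].

Definition isomorphic_to_Z (G : groupType) (K : set G) : Prop :=
  exists f : int -> G,
    [/\ injective f, {morph f : m n / m + n >-> (m * n)%g} & range f = K].

Definition virtually_Z (G : groupType) : Prop :=
  exists K : set G, [/\ is_subgroup K, finite_index K & isomorphic_to_Z K].

Definition non_elementary (G : groupType) : Prop :=
  ~ finite_set [set: G] /\ ~ virtually_Z G.

Definition finite_normal_subgroup (G : groupType) (N : set G) : Prop :=
  [/\ is_subgroup N, finite_set N & forall g : G, conj_set N g = N].

Definition is_max_finite_normal (G : groupType) (E : set G) : Prop :=
  finite_normal_subgroup E /\
  forall N : set G, finite_normal_subgroup N -> N `<=` E.

(* E(G). The predicate is satisfied by at most one set; the value [set 1] is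
   only used by [xget] for groups without a maximal finite normal subgroup. *)
Definition max_finite_normal (G : groupType) : set G :=
  xget [set 1%g] [set E | is_max_finite_normal E].
Arguments max_finite_normal G : clear implicits.

Definition non_degenerate (G : groupType) (P : set G) : Prop :=
  P !=set0 /\ P `&` max_finite_normal G = set0.

Definition confining_subset (G : groupType) (H P : set G) : Prop :=
  finite_set P /\
  forall g : G, conj_set H g `&` (P `\ 1%g) !=set0.

Definition proper_space (R : realType) (X : metricType R) : Prop :=
  forall (x : X) (r : R), compact [set y | mdist x y <= r].

Definition geodesic_space (R : realType) (X : metricType R) : Prop :=
  forall x y : X, exists gamma : R -> X,
    [/\ gamma 0 = x, gamma (mdist x y) = y &
        forall s t : R, 0 <= s <= mdist x y -> 0 <= t <= mdist x y ->
          mdist (gamma s) (gamma t) = `|s - t|].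

(* [inf] is 0 on the empty set, so this is the distance only for nonempty [Z]. *)
Definition dist_set (R : realType) (X : metricType R) (x : X) (Z : set X) : R :=
  inf [set mdist x z | z in Z].

Definition proj_set (R : realType) (X : metricType R) (Z : set X) (x : X) : set X :=
  [set y | Z y /\ mdist x y = dist_set x Z].

(* Extended-real valued: +oo for unbounded sets (and -oo for the empty set). *)
Definition diam (R : realType) (X : metricType R) (A : set X) : \bar R :=
  ereal_sup [set (mdist u v)%:E | u in A & v in A].

Definition contracting_set (R : realType) (X : metricType R) (C : R)
    (Z : set X) : Prop :=
  [/\ closed Z, 0 < C &
      forall x y : X, mdist x y <= dist_set x Z ->
        (diam (proj_set Z x `|` proj_set Z y) <= C%:E)%E].

Definition quasi_geodesic (R : realType) (X : metricType R) (f : int -> X) :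
    Prop :=
  exists lambda c : R, [/\ 1 <= lambda, 0 <= c &
    forall m n : int,
      lambda^-1 * `|m - n|%:~R - c <= mdist (f m) (f n)
        <= lambda * `|m - n|%:~R + c].

Definition isometric_action (R : realType) (X : metricType R) (G : groupType)
    (act : G -> X -> X) : Prop :=
  [/\ forall x, act 1%g x = x,
      forall g h x, act (g * h)%g x = act g (act h x) &
      forall g x y, mdist (act g x) (act g y) = mdist x y].

Definition proper_action (R : realType) (X : metricType R) (G : groupType)
    (act : G -> X -> X) : Prop :=
  forall K : set X, compact K -> finite_set [set g | act g @` K `&` K !=set0].

Definition contracting_element (R : realType) (X : metricType R)
    (G : groupType) (act : G -> X -> X) (o : X) (h : G) : Prop :=
  quasi_geodesic (fun n : int => act (expgz h n) o) /\
  exists C : R, contracting_set C (range (fun n : int => act (expgz h n) o)).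

Definition ballG (R : realType) (X : metricType R) (G : groupType)
    (act : G -> X -> X) (o : X) (n : nat) : set G :=
  [set g | mdist o (act g o) <= n%:R].

(* A set of left cosets, i.e. a subset of G/H. *)
Definition ballGH (R : realType) (X : metricType R) (G : groupType)
    (act : G -> X -> X) (o : X) (H : set G) (n : nat) : set (set G) :=
  [set left_coset H g | g in
    [set g | dist_set o ((fun k => act k o) @` left_coset H g) <= n%:R]].

(* [fset_set] is a junk value on infinite sets; the balls above are finite as
   soon as the action is proper and the space is proper. *)
Definition card_set (T : choiceType) (A : set T) : nat := #|` fset_set A|.

(* The term of index 0 is irrelevant to the limsup. *)
Definition growth_rate (R : realType) (X : metricType R) (G : groupType)
    (act : G -> X -> X) (o : X) : \bar R :=
  limn_esup (fun n : nat => (n%:R^-1 * ln (card_set (ballG act o n))%:R)%:E).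

Definition purely_exponential_growth (R : realType) (X : metricType R)
    (G : groupType) (act : G -> X -> X) (o : X) : Prop :=
  exists2 c : R, 1 <= c &
    forall n : nat, (1 <= n)%N ->
      c^-1 * expR (n%:R * fine (growth_rate act o))
        <= (card_set (ballG act o n))%:R
        <= c * expR (n%:R * fine (growth_rate act o)).

(* Main.v *)
Require Import Defs.
From HB Require Import structures.
From mathcomp Require Import all_boot all_order all_algebra finmap.
From mathcomp Require Import all_classical all_reals all_analysis.
From mathcomp Require Import ring lra zify.

(* Write |g| = d(o, go), and call z shortest if |z| is minimal in its coset zH,
   so that |B_{G/H}(n)| is at most the number of shortest z in B(n). Given y
   and z, confinement of H yields an element p of P such that
   w = g f^m g^-1 p g f^-m g^-1 lies in z H z^-1, where f is contracting, m is
   large and g is one of three fixed elements, chosen such that any geodesic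
   from o to ywzo passes near yo and ywo. The map (y, z) |-> ywz is then
   boundedly-many-to-one on shortest z: of two values of z with the same image
   and very different lengths, the longer one would contain a detour w that can
   be deleted without leaving the coset. Counting pairs with |y| + |z| <= n
   gives sum_z e^(-omega |z|) < oo over the shortest z, and a set with this
   property is negligible when |B(n)| grows like e^(omega n), omega > 0.

   For g to exist one needs g^-1 p g to move the axis of f to an axis with
   bounded projection for all p in P simultaneously. The stabiliser of the axis
   up to finite distance is the commensurator of <f>, and the intersection of
   its conjugates is E(G), which P avoids. *)

Set Implicit Arguments.
Unset Strict Implicit.
Unset Printing Implicit Defensive.

Import Order.TTheory GRing.Theory Num.Theory.
Import numFieldNormedType.Exports.

Local Open Scope classical_set_scope.
Local Open Scope ring_scope.

(** * Projections to contracting sets *)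

Section Contracting.
Context {R : realType} {X : metricType R}.
Implicit Types (x y z q r u v : X) (Z : set X) (C D B a b s t : R).
Implicit Types gamma : R -> X.

Definition nearest Z x q := Z q /\ forall z, Z z -> mdist x q <= mdist x z.

(** Contraction is expressed through pairs of nearest points, with their existence included, so that
    neither an infimum nor a diameter enters the estimates. *)
Definition contr C Z := [/\ 0 < C, forall x, exists q, nearest Z x q &
  forall x y q r, nearest Z x q -> nearest Z y r -> mdist x y <= mdist x q ->
    mdist q r <= C].

Definition geod gamma a b := forall s t, a <= s -> s <= t -> t <= b ->
  mdist (gamma s) (gamma t) = t - s.

Lemma geod_sub gamma a b a' b' :
  geod gamma a b -> a <= a' -> b' <= b -> geod gamma a' b'.
Proof. by move=> g aa bb s t hs st ht; apply: g => //; lra. Qed.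

Lemma geod_rev gamma a b :
  geod gamma a b -> geod (fun t => gamma (- t)) (- b) (- a).
Proof.
by move=> g s t hs st ht; rewrite metric_sym g; lra.
Qed.

Lemma nearest_self Z x : Z x -> nearest Z x x.
Proof. by move=> Zx; split=> // z _; rewrite mdistxx mdist_ge0. Qed.

(** Either [y] lies in the ball around [x] on which the projection contracts, or [d(x, q) < d(x, y)]
    and the triangle inequality through [x] and [y] costs at most [4 * d(x, y)]. *)
Lemma nearest_lip C Z x y q r : contr C Z -> nearest Z x q -> nearest Z y r ->
  mdist q r <= 4 * mdist x y + C.
Proof.
move=> [C0 _ ctr] xq yr.
have [xy|xy] := leP (mdist x y) (mdist x q).
  by have := ctr _ _ _ _ xq yr xy; have := mdist_ge0 x y; lra.
have := yr.2 _ xq.1.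
have := metric_triangle q x r; have := metric_triangle x y r.
have := metric_triangle y x q; rewrite (metric_sym q x) (metric_sym y x).
have := mdist_ge0 x y.
lra.
Qed.

(** The segment is cut into steps of length [2 * C], at most [N.+1] of them. Each step stays inside
    a contracting ball and moves the projection by at most [C], hence half speed; the last, shorter
    step costs the additive [C]. *)
Lemma far_step C Z gamma N : contr C Z -> forall a b q r, a <= b ->
  geod gamma a b ->
  (forall t z, a <= t -> t <= b -> Z z -> 2 * C <= mdist (gamma t) z) ->
  nearest Z (gamma a) q -> nearest Z (gamma b) r ->
  b - a <= 2 * C * N.+1%:R -> mdist q r <= C + (b - a) / 2.
Proof.
move=> ctr; have [C0 ex cc] := ctr.
elim: N => [|N IH] a b q r ab g far aq br.
  rewrite mulr1 => h.
  have : mdist q r <= C.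
    by apply: (cc _ _ _ _ aq br); rewrite g ?lexx// (le_trans h)// far ?lexx//; case: aq.
  lra.
have [h1 _|h1] := leP (b - a) (2 * C).
  have : mdist q r <= C.
    by apply: (cc _ _ _ _ aq br); rewrite g ?lexx// (le_trans h1)// far ?lexx//; case: aq.
  lra.
rewrite -(natr1 N.+1) mulrDr mulr1 => h.
have [p ap] := ex (gamma (a + 2 * C)).
have : mdist p r <= C + (b - (a + 2 * C)) / 2.
  apply: (IH _ _ _ _ _ _ _ ap br); [lra| |  |lra].
    by apply: (geod_sub g); lra.
  by move=> t z ht tb Zz; apply: far => //; lra.
have : mdist q p <= C.
  apply: (cc _ _ _ _ aq ap); rewrite g; [|lra..].
  have := far a q; rewrite lexx => /(_ isT ab aq.1); lra.
have := metric_triangle q p r.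
lra.
Qed.

(* Trimming the two end segments, whose projections have diameter at most C,
   leaves a segment of length at most the distance of the projections, while
   the projection travels at most at half speed. *)
Lemma far_proj C Z gamma a b q r : contr C Z -> a <= b -> geod gamma a b ->
  (forall t z, a <= t -> t <= b -> Z z -> 2 * C <= mdist (gamma t) z) ->
  nearest Z (gamma a) q -> nearest Z (gamma b) r -> mdist q r <= 6 * C.
Proof.
move=> ctr ab g far aq br; have [C0 ex cc] := ctr.
have gab : mdist (gamma a) (gamma b) = b - a by rewrite g.
set d1 := mdist (gamma a) q; set d2 := mdist (gamma b) r.
have d10 : 0 <= d1 by exact: mdist_ge0.
have d20 : 0 <= d2 by exact: mdist_ge0.
have [h1|h1] := leP (b - a) d1.
  by have := cc _ _ _ _ aq br; rewrite gab => /(_ h1); lra.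
have [p1 ap1] := ex (gamma (a + d1)).
have qp1 : mdist q p1 <= C by apply: (cc _ _ _ _ aq ap1); rewrite g; [rewrite -/d1|..]; lra.
have [h2|h2] := leP (b - a) (d1 + d2).
  have : mdist r p1 <= C.
    by apply: (cc _ _ _ _ br ap1); rewrite metric_sym g; [rewrite -/d2|..]; lra.
  by have := metric_triangle q p1 r; rewrite (metric_sym p1 r); lra.
have [p2 ap2] := ex (gamma (b - d2)).
have rp2 : mdist r p2 <= C.
  by apply: (cc _ _ _ _ br ap2); rewrite metric_sym g; [rewrite -/d2|..]; lra.
have [N hN] : exists N : nat, (b - d2) - (a + d1) <= 2 * C * N.+1%:R.
  exists (Num.truncn (((b - d2) - (a + d1)) / (2 * C))).
  rewrite mulrC -ler_pdivrMr; last by lra.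
  exact/ltW/truncnS_gt.
have : mdist p1 p2 <= C + ((b - d2) - (a + d1)) / 2.
  apply: far_step ctr _ _ _ _ _ _ _ ap1 ap2 hN; first by lra.
    by apply: (geod_sub g); lra.
  by move=> t z ht tb Zz; apply: far => //; lra.
have := metric_triangle q p1 r; have := metric_triangle p1 p2 r.
have := metric_triangle (gamma a) q (gamma b).
have := metric_triangle q r (gamma b).
rewrite gab (metric_sym r (gamma b)) -/d1 -/d2 (metric_sym p2 r).
lra.
Qed.

(** By [far_proj] the geodesic must enter the [2 * C]-neighbourhood of [Z]. Just before the first
    entry it is within [3 * C] of its projection, which [far_proj] places within [6 * C] of [q]. *)
Lemma bounded_image C Z gamma a b q r : contr C Z -> a <= b ->
  geod gamma a b -> nearest Z (gamma a) q -> nearest Z (gamma b) r ->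
  6 * C < mdist q r -> exists s, [/\ a <= s, s <= b & mdist (gamma s) q <= 9 * C].
Proof.
move=> ctr ab g aq br far; have [C0 ex cc] := ctr.
pose S := [set t | [/\ a <= t, t <= b & exists2 z, Z z & mdist (gamma t) z < 2 * C]].
have S0 : S !=set0.
  apply: contrapT => nS.
  have := far_proj ctr ab g _ aq br; suff h : forall t z, a <= t -> t <= b ->
    Z z -> 2 * C <= mdist (gamma t) z by move=> /(_ h); lra.
  move=> t z at_ tb Zz; rewrite leNgt; apply/negP => tz.
  by apply: nS; exists t; split=> //; exists z.
have Slb : has_lbound S by exists a => t [].
have [t0 [at0 t0b [z Zz t0z]] t0T] := inf_adherent C0 (conj S0 Slb).
have [h|h] := leP a (t0 - C); last first.
  exists a; split=> //.
  have := aq.2 _ Zz; have := metric_triangle (gamma a) (gamma t0) z.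
  by rewrite (g a t0)//; lra.
(* [t0] exceeds [inf S] by less than [C], so up to time [t0 - C] the geodesic has not yet entered
   the neighbourhood. *)
exists (t0 - C); split=> //; first by lra.
have [p tp] := ex (gamma (t0 - C)).
have : mdist q p <= 6 * C.
  apply: (far_proj ctr h _ _ aq tp); first by apply: (geod_sub g); lra.
  move=> t z' at_ tb Zz'; rewrite leNgt; apply/negP => tz.
  suff : inf S <= t by lra.
  by apply: ge_inf => //; split=> //; [lra|exists z'].
have := tp.2 _ Zz; have := metric_triangle (gamma (t0 - C)) (gamma t0) z.
rewrite (g (t0 - C) t0)//; last by lra.
have := metric_triangle (gamma (t0 - C)) p q; rewrite (metric_sym p q).
lra.
Qed.

Lemma bounded_image_r C Z gamma a b q r : contr C Z -> a <= b ->
  geod gamma a b -> nearest Z (gamma a) q -> nearest Z (gamma b) r ->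
  6 * C < mdist q r -> exists s, [/\ a <= s, s <= b & mdist (gamma s) r <= 9 * C].
Proof.
move=> ctr ab g aq br; rewrite metric_sym => far.
have [s [h1 h2 h3]] : exists s, [/\ - b <= s, s <= - a &
    mdist (gamma (- s)) r <= 9 * C].
  apply: (bounded_image ctr _ (geod_rev g) _ _ far); rewrite ?opprK//; lra.
by exists (- s); split=> //; lra.
Qed.

(** The geodesic is within [D + 9 * C] of [q] at some time before [t] and again at some time after
    [t], so these times differ by at most [2 * (D + 9 * C)]. *)
Lemma quasiconvex C Z gamma D a b t z z' q : contr C Z -> geod gamma a b ->
  0 <= D -> Z z -> mdist (gamma a) z <= D -> Z z' -> mdist (gamma b) z' <= D ->
  a <= t -> t <= b -> nearest Z (gamma t) q ->
  mdist (gamma t) q <= 3 * (D + 9 * C).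
Proof.
move=> ctr g D0 Zz az Zz' bz at_ tb tq; have [C0 ex cc] := ctr.
have [qa aqa] := ex (gamma a); have [qb bqb] := ex (gamma b).
have [s [as_ st sq]] : exists s, [/\ a <= s, s <= t & mdist (gamma s) q <= D + 9 * C].
  have [h|h] := leP (mdist qa q) (6 * C).
    exists a; split=> //; have := aqa.2 _ Zz.
    by have := metric_triangle (gamma a) qa q; lra.
  have gt : geod gamma a t by apply: (geod_sub g); lra.
  by have [s [? ? ?]] := bounded_image_r ctr at_ gt aqa tq h; exists s; split=> //; lra.
have [s' [ts sb sq']] : exists s, [/\ t <= s, s <= b & mdist (gamma s) q <= D + 9 * C].
  have [h|h] := leP (mdist q qb) (6 * C).
    exists b; split=> //; have := bqb.2 _ Zz'.
    by have := metric_triangle (gamma b) qb q; rewrite (metric_sym qb q); lra.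
  have gt : geod gamma t b by apply: (geod_sub g); lra.
  by have [s' [? ? ?]] := bounded_image ctr tb gt tq bqb h; exists s'; split=> //; lra.
have := metric_triangle (gamma t) (gamma s) q; rewrite (metric_sym _ (gamma s)).
have := metric_triangle (gamma s) q (gamma s'); rewrite (metric_sym q).
rewrite !g; lra.
Qed.

(** * Geodesics in the presence of two contracting sets *)

Hypothesis Xg : geodesic_space X.

Lemma geod_ex x y : exists gamma, [/\ gamma 0 = x, gamma (mdist x y) = y &
  geod gamma 0 (mdist x y)].
Proof.
have [gamma [g0 g1 g]] := Xg x y; exists gamma; split=> // s t s0 st tb.
rewrite g; first by rewrite distrC ger0_norm ?subr_ge0.
- by rewrite s0 (le_trans st).
- by rewrite tb (le_trans s0).
Qed.

(** A geodesic from [x] to [q2] passes within [9 * C] of [q1]. The point where it does still has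
    [q2] as a nearest point of [Z2], and [nearest_lip] gives [4 * 9 * C + C = 37 * C]. *)
Lemma behrstock C Z1 Z2 x q1 q2 r (s : X) : contr C Z1 -> contr C Z2 ->
  nearest Z1 x q1 -> nearest Z2 x q2 -> nearest Z1 q2 r -> nearest Z2 q1 s ->
  6 * C < mdist q1 r -> mdist q2 s <= 37 * C.
Proof.
move=> ctr1 ctr2 xq1 xq2 q2r q1s far.
have [gamma [g0 g1 g]] := geod_ex x q2.
have := bounded_image ctr1 (mdist_ge0 x q2) g.
rewrite g0 g1 => /(_ _ _ xq1 q2r far) [t [t0 tb tq]].
have vq2 : nearest Z2 (gamma t) q2.
  split=> [|z Zz]; first by case: xq2.
  have := g t _ t0 tb (lexx _); rewrite g1 => ->.
  have := g 0 t (lexx _) t0 tb; rewrite g0 subr0 => xt.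
  have := xq2.2 _ Zz; have := metric_triangle x (gamma t) z; lra.
by have := nearest_lip ctr2 vq2 q1s; lra.
Qed.

(* Here [gamma a] projects to [Z1] near [e], [Z2] projects to [Z1] near [e'],
   [Z1] projects to [Z2] near [k'], and [gamma b] projects to [Z2] near [k]:
   the path through these points fellow travels with [gamma]. *)
Lemma detour C Z1 Z2 B D D' L e e' k k' gamma a b :
  contr C Z1 -> contr C Z2 ->
  (forall u q, Z2 u -> nearest Z1 u q -> mdist q e' <= B) ->
  (forall u q, Z1 u -> nearest Z2 u q -> mdist q k' <= B) ->
  L <= mdist e e' -> L <= mdist k k' -> B + D + D' + 43 * C < L ->
  a <= b -> geod gamma a b ->
  (forall q, nearest Z1 (gamma a) q -> mdist q e <= D) ->
  (forall q, nearest Z2 (gamma b) q -> mdist q k <= D') ->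
  exists s, [/\ a <= s, s <= b & mdist (gamma s) e <= 9 * C + D].
Proof.
move=> ctr1 ctr2 B1 B2 ee kk hL ab g ae bk.
have [C0 ex1 _] := ctr1; have [_ ex2 _] := ctr2.
have [qa aqa] := ex1 (gamma a); have [qb bqb] := ex1 (gamma b).
have [p bp] := ex2 (gamma b); have [r qbr] := ex2 qb; have [s ps] := ex1 p.
have kb := bk _ bp; have kr := B2 _ _ bqb.1 qbr; have sB := B1 _ _ bp.1 ps.
have D0 : 0 <= D := le_trans (mdist_ge0 _ _) (ae _ aqa).
have D'0 : 0 <= D' := le_trans (mdist_ge0 _ _) kb.
have hs : mdist qb s <= 37 * C.
  apply: behrstock ctr2 ctr1 bp bqb qbr ps _.
  have := metric_triangle k p k'; have := metric_triangle p r k'.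
  by rewrite (metric_sym k p); lra.
have [t [? ? ?]] : exists s, [/\ a <= s, s <= b & mdist (gamma s) qa <= 9 * C].
  apply: (bounded_image ctr1 ab g aqa bqb).
  have := ae _ aqa; have := metric_triangle e qa e'.
  have := metric_triangle qa qb e'; have := metric_triangle qb s e'.
  by rewrite (metric_sym e qa); lra.
exists t; split=> //; have := ae _ aqa.
by have := metric_triangle (gamma t) qa e; lra.
Qed.

(** [detour] is applied first to [gamma], then to the reverse of the part after [s], which yields
    the order [s <= t]. As [gamma s] is near [e], it projects within [4 * (9 * C + D) + C] of [e];
    this is the source of [5 * D + 80 * C]. *)
Lemma detour_both C Z1 Z2 B D L e e' k k' gamma a b :
  contr C Z1 -> contr C Z2 -> Z1 e -> Z2 k ->
  (forall u q, Z2 u -> nearest Z1 u q -> mdist q e' <= B) ->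
  (forall u q, Z1 u -> nearest Z2 u q -> mdist q k' <= B) ->
  L <= mdist e e' -> L <= mdist k k' -> B + 5 * D + 80 * C < L ->
  a <= b -> geod gamma a b ->
  (forall q, nearest Z1 (gamma a) q -> mdist q e <= D) ->
  (forall q, nearest Z2 (gamma b) q -> mdist q k <= D) ->
  exists s t, [/\ a <= s, s <= t, t <= b, mdist (gamma s) e <= 9 * C + D &
    mdist (gamma t) k <= 9 * C + D].
Proof.
move=> ctr1 ctr2 Z1e Z2k B1 B2 ee kk hL ab g ae bk.
have [C0 ex1 _] := ctr1; have [_ ex2 _] := ctr2.
have D0 : 0 <= D.
  by have [qa aqa] := ex1 (gamma a); apply: le_trans (ae _ aqa); exact: mdist_ge0.
have hL' : B + D + D + 43 * C < L by lra.
have [s [as_ sb se]] := detour ctr1 ctr2 B1 B2 ee kk hL' ab g ae bk.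
have gs : geod gamma s b by apply: (geod_sub g).
have [] := @detour C Z2 Z1 B D (4 * (9 * C + D) + C) L k k' e e'
  (fun t => gamma (- t)) (- b) (- s) ctr2 ctr1 B2 B1 kk ee.
- lra.
- lra.
- exact: geod_rev gs.
- by rewrite opprK.
- rewrite opprK => q sq.
  by have := nearest_lip ctr1 sq (nearest_self Z1e); lra.
move=> t [h1 h2 h3]; exists s, (- t); split=> //; lra.
Qed.

End Contracting.

(** * Finite sets *)

(** [N] depends on [A] alone, so it may be fixed before the sequence, for instance to decide how
    long a geodesic to take. *)
Lemma finite_pigeonhole (T : choiceType) (A : set T) : finite_set A ->
  exists N : nat, forall phi : nat -> T, (forall k, (k <= N)%N -> A (phi k)) ->
    exists k l, [/\ (k < l)%N, (l <= N)%N & phi k = phi l].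
Proof.
move=> /finite_seqP[s ->]; exists (size s) => phi phis.
have : ~~ uniq [seq phi k | k <- iota 0 (size s).+1].
  apply/negP => /uniq_leq_size.
  rewrite size_map size_iota => /(_ s); rewrite ltnn => h.
  apply: notF; apply: h => y /mapP[k]; rewrite mem_iota => /andP[_ ks] ->.
  by apply: phis; rewrite -ltnS.
move=> /(uniqPn (phi 0%N))[k [l []]]; rewrite size_map size_iota => kl ls.
rewrite !(nth_map 0%N) ?size_iota ?(ltn_trans kl)// !nth_iota ?(ltn_trans kl)//.
by rewrite !add0n => e; exists k, l.
Qed.

Lemma infinite_injection (T : choiceType) (A : set T) : ~ finite_set A ->
  exists2 phi : nat -> T, injective phi & forall k, A (phi k).
Proof.
elim/choicePpointed: T => T in A *; first by rewrite emptyE.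
move=> /infiniteP/pcard_leP/injfunPex[phi phiA phiI].
by exists phi => [k l /phiI|k]; [apply; rewrite inE|exact: phiA].
Qed.

Lemma finite_argmin (R : realDomainType) (T : choiceType) (A : set T)
    (h : T -> R) : A !=set0 -> (forall r, finite_set (A `&` [set x | h x <= r])) ->
  exists2 x, A x & forall y, A y -> h x <= h y.
Proof.
move=> [x0 Ax0] /(_ (h x0)) /finite_seqP[s sE].
have {Ax0} x0s : x0 \in s.
  have : (A `&` [set x | h x <= h x0]) x0 by split=> /=.
  by rewrite sE.
have [x xs xmin] : exists2 x, x \in s & forall y, y \in s -> h x <= h y.
  case: s x0s {sE} => // a s _; elim: s a => [|b s IH] a.
    by exists a; rewrite ?mem_head// => y; rewrite inE => /eqP ->.
  have [x xs xm] := IH b; have [hx|/ltW hx] := leP (h x) (h a).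
    exists x; first by rewrite inE xs orbT.
    by move=> y; rewrite inE => /orP[/eqP ->|/xm].
  exists a; first by rewrite mem_head.
  by move=> y; rewrite inE => /orP[/eqP ->//|/xm]; exact: le_trans.
have : [set` s] x by [].
rewrite -sE => -[Ax hx0]; exists x => // y Ay.
have [hy|/ltW] := leP (h y) (h x0); last exact: le_trans.
apply: xmin; have : (A `&` [set x | h x <= h x0]) y by [].
by rewrite sE.
Qed.

Lemma finite_uniform_bound (R : realDomainType) (T : choiceType) (A : set T)
    (Q : T -> R -> Prop) : finite_set A ->
  (forall x B B', B <= B' -> Q x B -> Q x B') ->
  (forall x, A x -> exists B, Q x B) -> exists B, forall x, A x -> Q x B.
Proof.
move=> /finite_seqP[s ->] mono; elim: s => [|a s IH] h; first by exists 0.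
have [B1 B1P] := h a (mem_head _ _).
have [|B2 B2P] := IH; first by move=> x xs; apply: h; rewrite /= inE xs orbT.
exists (Num.max B1 B2) => x; rewrite /= inE => /orP[/eqP ->|/B2P].
- by apply: mono B1P; rewrite le_max lexx.
- by apply: mono; rewrite le_max lexx orbT.
Qed.

(** * Integer powers *)

Section IntPowers.
Context {G : groupType}.
Implicit Types (g h x y : G) (m n : int).

Lemma expgzS h n : expgz h (n + 1) = (expgz h n * h)%g.
Proof.
case: n => [k|[|k]]; first by rewrite addrC -intS /= expgSr.
  by rewrite /= expg1 mulVg.
have -> : Negz k.+1 + 1 = Negz k by lia.
by rewrite /= (expgS _ k.+1) invgM mulgVK.
Qed.

Lemma expgzB1 h n : expgz h (n - 1) = (expgz h n / h)%g.
Proof. by rewrite -{2}(subrK 1 n) expgzS mulgK. Qed.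

Lemma expgzD h m n : expgz h (m + n) = (expgz h m * expgz h n)%g.
Proof.
elim/int_rect: n => [|n IH|n IH]; first by rewrite addr0 mulg1.
  by rewrite -addn1 PoszD addrA !expgzS IH mulgA.
by rewrite -addn1 PoszD opprD addrA !expgzB1 IH mulgA.
Qed.

Lemma expgzN h n : expgz h (- n) = ((expgz h n)^-1)%g.
Proof.
by apply/esym/mulg1_eq; rewrite -expgzD subrr.
Qed.

Lemma expgz_comm h m n : (expgz h m * expgz h n = expgz h n * expgz h m)%g.
Proof. by rewrite -!expgzD addrC. Qed.

Lemma expgz_intertwine g x y n :
  (g * x = y * g)%g -> (g * expgz x n = expgz y n * g)%g.
Proof.
move=> e; elim/int_rect: n => [|n IH|n IH]; first by rewrite mulg1 mul1g.
  by rewrite -addn1 PoszD !expgzS mulgA IH -mulgA e mulgA.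
rewrite -addn1 PoszD opprD !expgzB1 mulgA IH -!mulgA; congr (_ * _)%g.
by apply: (mulgI y); rewrite !mulgA mulgV mul1g -e mulgK.
Qed.

Lemma expgzM h m n : expgz h (m * n) = expgz (expgz h m) n.
Proof.
elim/int_rect: n => [|n IH|n IH]; first by rewrite mulr0.
  by rewrite -addn1 PoszD mulrDr mulr1 (expgzD h) expgzS IH.
by rewrite -addn1 PoszD opprD mulrBr mulr1 (expgzD h) expgzN expgzB1 IH.
Qed.

End IntPowers.

(** * Translates of the axis of a contracting element *)

Section Action.
Context {R : realType} {X : metricType R} {G : groupType}.
Variables (act : G -> X -> X) (o : X) (f : G).
Implicit Types (g h p : G) (m n : int) (B r : R).

Local Notation pt g := (act g o).
Local Notation len g := (mdist o (act g o)).
Local Notation F := (expgz f).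
(** Rewriting with [!gs] brings a group expression to normal form: inverses pushed inwards, products
    associated to the left, adjacent inverses cancelled. *)
Let gs := (@invgM G, @invgK G, @mulgA G, @mulgK G, @mulgVK G, @mulgV G,
  @mulVg G, @mul1g G, @mulg1 G, @invg1 G).

Definition axis g : set X := [set pt (g * F n)%g | n in [set: int]].

Definition bounded_proj g B :=
  forall u q, axis g u -> nearest (axis 1%g) u q -> mdist q o <= B.

(** Membership in the commensurator of the cyclic group generated by [f]. That [b] is nonzero as
    well follows once [f] has infinite order. *)
Definition commensurates g :=
  exists a b : int, a != 0 /\ (g * F a = F b * g)%g.

Hypothesis iso : isometric_action act.

Lemma act1 x : act 1%g x = x. Proof. by case: iso. Qed.
Lemma actM g h x : act (g * h)%g x = act g (act h x). Proof. by case: iso. Qed.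
Lemma mdist_act g x y : mdist (act g x) (act g y) = mdist x y.
Proof. by case: iso. Qed.

Lemma mdist_pt g h : mdist (pt g) (pt h) = len (g^-1 * h)%g.
Proof. by rewrite -(mdist_act g^-1%g) -!actM mulVg act1. Qed.

Lemma lenV g : len g^-1%g = len g.
Proof. by rewrite -(mdist_act g) -actM mulgV act1 metric_sym. Qed.

Lemma lenM g h : len (g * h)%g <= len g + len h.
Proof.
by rewrite -(mdist_act g o (pt h)) -actM; exact: metric_triangle.
Qed.

Lemma axis_base g : axis g (pt g).
Proof. by exists 0 => //=; rewrite mulg1. Qed.

Lemma axis_act g h u : axis g u -> axis (h * g)%g (act h u).
Proof. by case=> n _ <-; exists n => //; rewrite -actM mulgA. Qed.

Lemma axis_shift g n : axis (g * F n)%g = axis g.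
Proof.
apply/seteqP; split=> _ [m _ <-].
  by exists (n + m) => //; rewrite expgzD mulgA.
by exists (m - n) => //; rewrite -mulgA -expgzD addrC subrK.
Qed.

Lemma nearest_act g h x q :
  nearest (axis g) x q -> nearest (axis (h * g)%g) (act h x) (act h q).
Proof.
move=> [gq xq]; split; first exact: axis_act.
move=> z /(axis_act h^-1%g); rewrite !gs => /xq.
by rewrite -(mdist_act h x (act h^-1%g z)) -actM !gs act1 mdist_act.
Qed.

Lemma nearest_actV g h x q :
  nearest (axis (h * g)%g) x q -> nearest (axis g) (act h^-1%g x) (act h^-1%g q).
Proof. by move/(nearest_act h^-1%g); rewrite !gs. Qed.

Lemma contr_axis C g : contr C (axis 1%g) -> contr C (axis g).
Proof.
move=> [C0 ex cc]; split=> // [x|x y q r xq yr].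
  have [q /(nearest_act g) xq] := ex (act g^-1%g x).
  by exists (act g q); move: xq; rewrite -actM !gs act1.
have gn z w : nearest (axis g) z w ->
    nearest (axis 1%g) (act g^-1%g z) (act g^-1%g w).
  by rewrite -(mulVg g); exact: nearest_act.
rewrite -(mdist_act g^-1%g x) -(mdist_act g^-1%g x q) -(mdist_act g^-1%g q).
exact: cc (gn _ _ xq) (gn _ _ yr).
Qed.

Lemma bounded_proj_at t g B u q : bounded_proj g B ->
  axis (t * g)%g u -> nearest (axis t) u q -> mdist q (pt t) <= B.
Proof.
move=> bp tu uq; rewrite -(mdist_act t^-1%g) -(actM _ t) mulVg act1.
apply: (bp (act t^-1%g u)).
  by move: tu => /(axis_act t^-1%g); rewrite !gs.
by apply: nearest_actV; rewrite mulg1.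
Qed.

Lemma bounded_proj_le g B B' : B <= B' -> bounded_proj g B -> bounded_proj g B'.
Proof. by move=> BB bp u q gu uq; apply: le_trans BB; exact: bp uq. Qed.

Hypothesis finball : forall r, finite_set [set g | len g <= r].
Hypothesis fproper :
  forall r, exists N : nat, forall n, len (F n) <= r -> (`|n| <= N)%N.

Lemma expgz_inj : injective F.
Proof.
move=> m n mn; have [N hN] := fproper 0.
have F1 : F (m - n) = 1%g by rewrite expgzD expgzN mn mulgV.
have := hN ((m - n) * N.+1%:Z); rewrite expgzM F1.
have -> : expgz (1 : G)%g N.+1 = 1%g by rewrite /= expg1n.
by rewrite act1 mdistxx lexx => /(_ isT); rewrite abszM absz_nat; nia.
Qed.

Lemma commensurates1 : commensurates 1%g.
Proof. by exists 1, 1; rewrite mul1g mulg1. Qed.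

Lemma commensurates_pow n : commensurates (F n).
Proof. by exists 1, 1; rewrite expgz_comm. Qed.

Lemma commensuratesM g h :
  commensurates g -> commensurates h -> commensurates (g * h)%g.
Proof.
move=> [a [b [a0 gab]]] [c [d [c0 hcd]]]; exists (c * a), (b * d).
split; first by rewrite mulf_neq0.
have := expgz_intertwine a hcd; rewrite -!expgzM => e1.
have := expgz_intertwine d gab; rewrite -!expgzM => e2.
by rewrite -mulgA e1 !mulgA (mulrC d) e2.
Qed.

Lemma commensuratesV g : commensurates g -> commensurates g^-1%g.
Proof.
move=> [a [b [a0 gab]]]; exists b, a; split.
  apply: contra_neq a0 => b0; apply: expgz_inj.
  by apply: (mulgI g); rewrite gab b0 mul1g mulg1.
by apply: (mulgI g); rewrite !gs gab !gs.
Qed.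

(** * Unbounded projection between axes characterises the commensurator *)

Variable C : R.
Hypothesis ctr : contr C (axis 1%g).
Hypothesis Xg : geodesic_space X.

(** Since [F (b * k) * g = g * F (a * k)], the axis of [g] is invariant under [F (b * k)], so the
    projections of its points include the translates of [q] by these powers, which leave every
    ball. *)
Lemma commensurates_unbounded g : commensurates g -> forall B, ~ bounded_proj g B.
Proof.
move=> cg B bp; have [C0 ex _] := ctr.
have [a [b [a0 gab]]] := cg.
have b0 : b != 0.
  apply: contra_neq a0 => b0; apply: expgz_inj.
  by apply: (mulgI g); rewrite gab b0 mul1g mulg1.
have [q gq] := ex (pt g).
have [N hN] := fproper (B + mdist q o).
have : (`|(b * N.+1%:Z)%R| <= N)%N.
  apply: hN.
  have gq' : nearest (axis 1%g) (pt (F (b * N.+1) * g)%g) (act (F (b * N.+1)) q).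
    have := nearest_act (F (b * N.+1)) gq.
    by rewrite mulg1 -[X in axis X]mul1g axis_shift actM.
  have := bp _ _ _ gq'; have -> : (F (b * N.+1) * g)%g = (g * F (a * N.+1))%g.
    by have := expgz_intertwine N.+1 gab; rewrite -!expgzM => ->.
  have /[swap]/[apply] : axis g (pt (g * F (a * N.+1))%g) by exists (a * N.+1).
  have := metric_triangle (pt (F (b * N.+1))) (act (F (b * N.+1)) q) o.
  rewrite (metric_sym _ o) mdist_act (metric_sym o q); lra.
by rewrite abszM absz_nat; nia.
Qed.

(* A geodesic joining far away points of [axis g] with far away projections to
   [axis 1] fellow travels with both axes. *)
Lemma unbounded_fellow g : (forall B, ~ bounded_proj g B) -> forall L,
  exists gamma a b, [/\ geod gamma a b, a <= b, L <= b - a &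
    forall t, a <= t -> t <= b -> exists n m,
      mdist (gamma t) (pt (g * F n)%g) <= 54 * C /\
      mdist (gamma t) (pt (F m)) <= 54 * C].
Proof.
move=> unb L; have [C0 ex cc] := ctr; have [_ exg _] := contr_axis g ctr.
have [q0 gq0] := ex (pt g).
have [u [q [gu uq qfar]]] : exists u q, [/\ axis g u, nearest (axis 1%g) u q &
    `|L| + 24 * C + mdist q0 o < mdist q o].
  apply: contrapT => nuq; apply: (unb (`|L| + 24 * C + mdist q0 o)) => u q gu uq.
  by rewrite leNgt; apply/negP => h; apply: nuq; exists u, q.
have {}qfar : `|L| + 24 * C < mdist q0 q.
  by have := metric_triangle q q0 o; rewrite (metric_sym q q0); lra.
have L0 := normr_ge0 L; have LL := ler_norm L.
have [gamma [e0 e1 ge]] := geod_ex Xg (pt g) u.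
have d0 := mdist_ge0 (pt g) u.
have g0 : nearest (axis 1%g) (gamma 0) q0 by rewrite e0.
have g1 : nearest (axis 1%g) (gamma (mdist (pt g) u)) q by rewrite e1.
have far : 6 * C < mdist q0 q by lra.
have [s [s0 sd sq]] := bounded_image ctr d0 ge g0 g1 far.
have [s' [s'0 s'd sq']] := bounded_image_r ctr d0 ge g0 g1 far.
have ss' : L <= mdist (gamma s) (gamma s').
  have := metric_triangle q0 (gamma s) q; have := metric_triangle (gamma s) (gamma s') q.
  by rewrite (metric_sym q0 (gamma s)); lra.
(* Nothing orders the times [s] and [s'], so they are sorted here. *)
have [a [b [a0 ab bd hab]]] : exists a b, [/\ 0 <= a, a <= b,
    b <= mdist (pt g) u & [/\ L <= b - a, exists2 z, axis 1%g z &
    mdist (gamma a) z <= 9 * C & exists2 z, axis 1%g z & mdist (gamma b) z <= 9 * C]].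
  have Aq0 := gq0.1; have Aq := uq.1.
  have [h|/ltW h] := leP s s'.
    exists s, s'; split=> //; split; [|by exists q0|by exists q].
    by rewrite -(ge s s').
  exists s', s; split=> //; split; [|by exists q|by exists q0].
  by rewrite -(ge s' s)// metric_sym.
have [Lab [z Az az] [z' Az' bz']] := hab.
exists gamma, a, b; split=> // [|t at_ tb]; first exact: geod_sub ge a0 bd.
have [p tp] := exg (gamma t); have [p' tp'] := ex (gamma t).
have [[n _ np] _] := tp; have [[m _ mp] _] := tp'.
exists n, m; split.
  rewrite np.
  have : mdist (gamma t) p <= 3 * (0 + 9 * C).
    apply: (quasiconvex (contr_axis g ctr) ge (lexx 0) (axis_base g) _ gu _ _ _ tp).
    - by rewrite e0 mdistxx.
    - by rewrite e1 mdistxx.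
    - exact: le_trans at_.
    - exact: le_trans bd.
  lra.
rewrite -[F m]mul1g mp.
(* The ends of the segment are only [9 * C]-close to [axis 1], whereas they come from a geodesic
   with both ends on [axis g]; this is the larger bound, [54 * C]. *)
have : mdist (gamma t) p' <= 3 * (9 * C + 9 * C).
  apply: (quasiconvex ctr (geod_sub ge a0 bd) _ Az az Az' bz' at_ tb tp'); lra.
lra.
Qed.

Lemma unbounded_close g : (forall B, ~ bounded_proj g B) ->
  exists n m, len (F (- m) * g * F n)%g <= 108 * C.
Proof.
move=> /unbounded_fellow /(_ 0)[gamma [a [b [_ ab _ /(_ a (lexx _) ab)[n [m [h1 h2]]]]]]].
exists n, m; rewrite expgzN -mulgA -mdist_pt.
have := metric_triangle (pt (F m)) (gamma a) (pt (g * F n)%g).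
by rewrite (metric_sym _ (gamma a)); lra.
Qed.

(** Points spaced by [d] along a long fellow-travelling segment give elements [F (- m) * g * F n] of
    length at most [108 * C]. Two of them coincide, and this is a commensuration relation; its
    exponent is nonzero because [d] exceeds [108 * C]. *)
Lemma unbounded_commensurates g : (forall B, ~ bounded_proj g B) -> commensurates g.
Proof.
move=> unb; have [C0 _ _] := ctr.
have [N hN] := finite_pigeonhole (finball (108 * C)).
pose d := 109 * C.
have [gamma [a [b [ge ab Lab fel]]]] := unbounded_fellow unb (N%:R * d).
have at_ k : (k <= N)%N -> a <= a + k%:R * d /\ a + k%:R * d <= b.
  move=> kN; have k0 : 0 <= k%:R * d by rewrite mulr_ge0// /d; lra.
  have : k%:R * d <= N%:R * d by rewrite ler_wpM2r ?ler_nat// /d; lra.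
  lra.
have /choice[w wP] : forall k : nat, exists w : int * int, (k <= N)%N ->
    mdist (gamma (a + k%:R * d)) (pt (g * F w.1)%g) <= 54 * C /\
    mdist (gamma (a + k%:R * d)) (pt (F w.2)) <= 54 * C.
  move=> k; have [kN|kN] := leqP k N; last by exists (0, 0).
  have [h1 h2] := at_ _ kN; have [n [m h]] := fel _ h1 h2.
  by exists (n, m).
have [|k [l [kl lN e]]] := hN (fun k => (F (w k).2)^-1 * (g * F (w k).1))%g.
  move=> k kN /=; rewrite -mdist_pt; have [h1 h2] := wP _ kN.
  have := metric_triangle (pt (F (w k).2)) (gamma (a + k%:R * d)) (pt (g * F (w k).1)%g).
  by rewrite (metric_sym _ (gamma _)); lra.
exists ((w k).1 - (w l).1), ((w k).2 - (w l).2); split; last first.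
  rewrite !expgzD !expgzN.
  have : (F (w k).2 * ((F (w k).2)^-1 * (g * F (w k).1)) * (F (w l).1)^-1 =
          F (w k).2 * ((F (w l).2)^-1 * (g * F (w l).1)) * (F (w l).1)^-1)%g by rewrite e.
  by rewrite !gs.
rewrite subr_eq0; apply/eqP => wkl.
have kN : (k <= N)%N by apply: leq_trans lN; exact: ltnW.
have [h1 _] := wP _ kN; have [h2 _] := wP _ lN.
have [ak kb] := at_ _ kN; have [al lb] := at_ _ lN.
have kld : d <= l%:R * d - k%:R * d.
  rewrite -mulrBl -natrB 1?ltnW// ler_peMl//; first by rewrite /d; lra.
  by rewrite ler1n subn_gt0.
have := metric_triangle (gamma (a + k%:R * d)) (pt (g * F (w k).1)%g) (gamma (a + l%:R * d)).
rewrite ge//; last by rewrite /d in kld *; lra.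
rewrite {2}wkl (metric_sym (pt (g * F (w l).1)%g)).
rewrite /d in h1 h2 kld *; lra.
Qed.

Lemma bounded_projP g : ~ commensurates g -> exists B, bounded_proj g B.
Proof.
move=> ng; apply: contrapT => nB; apply: ng; apply: unbounded_commensurates.
by move=> B bp; apply: nB; exists B.
Qed.

(** The cyclic group has finite index in its commensurator: [g = F m * k * F (- n)] with [k] in a
    finite ball, and a relation [k * F a = F b * k] reduces the right exponent modulo [a]. *)
Lemma commensurates_cosets : exists S : set G, finite_set S /\
  forall g, commensurates g -> exists n, exists2 s, S s & g = (F n * s)%g.
Proof.
pose K := [set g | len g <= 108 * C] `&` [set g | commensurates g].
have /choice[a aP] : forall k : G, exists a : nat, K k -> (0 < a)%N /\
    exists b, (k * F a%:Z = F b * k)%g.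
  move=> k; have [[_ kE]|] := pselect (K k); last by exists 0%N.
  have [a [b [a0 kab]]] := kE; exists `|a|%N => _; rewrite absz_gt0; split=> //.
  have [h|/ltW h] := leP 0 a; first by exists b; rewrite gez0_abs.
  exists (- b); rewrite lez0_abs// !expgzN.
  apply: (mulIg (F a)); rewrite !gs; apply: (mulgI (F b)); rewrite !gs.
  by rewrite kab.
exists (\bigcup_(k in K) [set k * F j%:Z | j in `I_(a k)])%g; split.
  apply: bigcup_finite => [|k _]; last exact/finite_image/finite_II.
  exact: finite_setIl.
move=> g gE; have [n [m nm]] := unbounded_close (commensurates_unbounded gE).
set k := (F (- m) * g * F n)%g in nm.
have Kk : K k.
  split=> //=; do 2?[apply: commensuratesM => //]; exact: commensurates_pow.
have [a0 [b kb]] := aP k Kk.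
have gk : g = (F m * k * F (- n))%g by rewrite /k !expgzN !gs.
clearbody k; have nE := divz_eq (- n) (a k)%:Z.
have a0' : (a k)%:Z != 0 by lia.
have r0 := modz_ge0 (- n) a0'; have ra := ltz_mod (- n) a0'.
set r := modz _ _ in nE r0 ra.
exists (m + b * (- n %/ a k)%Z), (k * F r)%g.
  exists k => //; exists `|r|%N; last by rewrite gez0_abs.
  by rewrite /=; lia.
have := expgz_intertwine (- n %/ a k)%Z kb; rewrite -!expgzM => e.
have Fn : F (- n) = (F ((a k)%:Z * (- n %/ a k)%Z) * F r)%g.
  by rewrite {1}nE expgzD mulrC.
by rewrite gk Fn expgzD !mulgA -(mulgA (F m) k) e !mulgA.
Qed.

Lemma commensurates_seq (phi : nat -> G) : (forall k, commensurates (phi k)) ->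
  exists k l n, (k < l)%N /\ phi k = (F n * phi l)%g.
Proof.
move=> phiE; have [S [finS SP]] := commensurates_cosets.
have /choice[w wP] : forall k, exists w : int * G, S w.2 /\ phi k = (F w.1 * w.2)%g.
  by move=> k; have [n [s Ss e]] := SP _ (phiE k); exists (n, s).
have [N hN] := finite_pigeonhole finS.
have [|k [l [kl _ e]]] := hN (fun k => (w k).2); first by move=> k _; case: (wP k).
exists k, l, ((w k).1 - (w l).1); split=> //.
have [_ ->] := wP k; have [_ ->] := wP l.
by rewrite e expgzD expgzN !gs.
Qed.

(** Two powers of the conjugate lie in the same coset of the cyclic group, so a nontrivial power of
    [x^-1 * F n * x] is itself some [F m]. *)
Lemma commensurates_conj_pow x n : n != 0 ->
  commensurates (x^-1 * F n * x)%g -> commensurates x.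
Proof.
move=> n0 h.
have conjpow j : (x * expgz (x^-1 * F n * x)%g j = F (n * j) * x)%g.
  by rewrite expgzM; apply: expgz_intertwine; rewrite !gs.
have powE k : commensurates (expgz (x^-1 * F n * x)%g k%:Z).
  elim: k => [|k IH]; first exact: commensurates1.
  by rewrite -addn1 PoszD expgzS; exact: commensuratesM.
have [k [l [m [kl e]]]] := commensurates_seq powE.
have e' : expgz (x^-1 * F n * x)%g (k%:Z - l%:Z) = F m.
  by rewrite expgzD expgzN e !gs.
have mx : (x * F m = F (n * (k%:Z - l%:Z)) * x)%g by rewrite -e' conjpow.
exists m, (n * (k%:Z - l%:Z)); split=> //.
have : n * (k%:Z - l%:Z) != 0 by rewrite mulf_neq0//; lia.
apply: contra_neq => m0; apply: expgz_inj.
by apply: (mulIg x); rewrite -mx m0 mulg1 mul1g.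
Qed.

(** * Conjugating elements out of the commensurator *)

Hypothesis not_commensurated : exists g, ~ commensurates g.

(* Translating a far away axis [axis (F n * x)] by [p] changes its projection
   to [axis 1] by a lot, so p does not coarsely preserve it. *)
Lemma commensurates_escape p x : ~ commensurates p -> ~ commensurates x ->
  exists N : nat, forall n, (N < `|n|)%N ->
    ~ commensurates (x^-1 * F (- n) * p * F n * x)%g.
Proof.
move=> np nx; have [C0 ex _] := ctr; have [_ exp _] := contr_axis p ctr.
have [B bB] := bounded_projP np.
have np' : ~ commensurates p^-1%g by move/commensuratesV; rewrite invgK.
have [B' bB'] := bounded_projP np'.
have [D bD] := bounded_projP nx.
(* [B'] and [D] make the projections far enough apart for [behrstock]; the final contradiction uses
   [B], [D] and [37 * C + 433 * C], the latter from [nearest_lip] at distance [108 * C]. *)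
have [N hN] := fproper (B + `|B'| + 2 * `|D| + 500 * C); exists N => n nN eE.
have [k [m]] := unbounded_close (commensurates_unbounded eE).
(* [u] lies on the axis of [F n * x] and [u'] on its translate by [p]; commensuration brings them
   close. *)
set u := pt (F n * x * F m)%g; set u' := pt (p * F n * x * F k)%g => km.
have uu' : mdist u u' <= 108 * C.
  by rewrite mdist_pt; move: km; rewrite !expgzN !gs.
have [q uq] := ex u; have [q1 uq1] := exp u'; have [q2 uq2] := ex u'.
have [r q2r] := exp q2; have [s q1s] := ex q1.
have hq : mdist q (pt (F n)) <= D.
  apply: (bounded_proj_at bD (u := u)); first by exists m.
  by rewrite -[F n]mul1g axis_shift.
have hq1 : mdist q1 (pt (p * F n)%g) <= D.
  apply: (bounded_proj_at bD (u := u')); first by exists k.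
  by rewrite axis_shift.
have hr : mdist r (pt p) <= B'.
  by apply: (bounded_proj_at bB' (u := q2)) => //; rewrite mulgV; exact: uq2.1.
have hs : mdist s o <= B by apply: bB q1s; exact: uq1.1.
have lF : B + `|B'| + 2 * `|D| + 500 * C < len (F n).
  by rewrite ltNge; apply/negP => /hN; rewrite leqNgt nN.
have DD := ler_norm D; have BB := ler_norm B'.
have D0 := normr_ge0 D; have B0 := normr_ge0 B'.
have B00 := le_trans (mdist_ge0 _ _) hs.
have far : 6 * C < mdist q1 r.
  have : mdist (pt p) (pt (p * F n)%g) = len (F n) by rewrite mdist_pt !gs.
  have := metric_triangle (pt p) r (pt (p * F n)%g).
  have := metric_triangle r q1 (pt (p * F n)%g).
  rewrite (metric_sym (pt p) r) (metric_sym r q1); lra.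
have := behrstock Xg (contr_axis p ctr) ctr uq1 uq2 q2r q1s far.
have := nearest_lip ctr uq uq2.
have := metric_triangle o s (pt (F n)); have := metric_triangle s q2 (pt (F n)).
have := metric_triangle q2 q (pt (F n)).
rewrite (metric_sym o s) (metric_sym s q2) (metric_sym q2 q); lra.
Qed.

Lemma commensurates_escape_seq (ps : seq G) x :
  (forall p, p \in ps -> ~ commensurates p) -> ~ commensurates x ->
  exists N : nat, forall n, (N < `|n|)%N -> forall p, p \in ps ->
    ~ commensurates (x^-1 * F (- n) * p * F n * x)%g.
Proof.
move=> + nx; elim: ps => [|p ps IH] nps; first by exists 0%N.
have [N1 h1] := commensurates_escape (nps p (mem_head _ _)) nx.
have [|N2 h2] := IH; first by move=> q qs; apply: nps; rewrite inE qs orbT.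
exists (maxn N1 N2) => n nN q; rewrite inE => /orP[/eqP ->|].
  by apply: h1; apply: leq_ltn_trans nN; rewrite leq_maxl.
by apply: h2; apply: leq_ltn_trans nN; rewrite leq_maxr.
Qed.

(** Almost malnormality of the commensurator. Two terms in one coset have a quotient [F n] with [n]
    nonzero by injectivity, and [commensurates_conj_pow] applies to it. *)
Lemma infinite_conj_commensurates x (phi : nat -> G) : injective phi ->
  (forall k, commensurates (phi k)) ->
  (forall k, commensurates (x^-1 * phi k * x)%g) -> commensurates x.
Proof.
move=> phiI phiE phiE'; have [k [l [n [kl e]]]] := commensurates_seq phiE.
have n0 : n != 0.
  apply/eqP => n0; move: e; rewrite n0 mul1g => /phiI kl'.
  by rewrite kl' ltnn in kl.
apply: (commensurates_conj_pow n0).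
have -> : (x^-1 * F n * x = x^-1 * phi k * x * (x^-1 * phi l * x)^-1)%g.
  by rewrite e !gs.
by apply: commensuratesM => //; exact: commensuratesV.
Qed.

(** Induction on [ps]: if [g] fails only for the new [p], it is replaced by [g * F n * x]. Any large
    [n] keeps the earlier elements outside the commensurator, and some large [n] also expels [p]. *)
Lemma simultaneous_escape (ps : seq G) :
  (forall p, p \in ps -> exists g, ~ commensurates (g^-1 * p * g)%g) ->
  exists g, forall p, p \in ps -> ~ commensurates (g^-1 * p * g)%g.
Proof.
elim: ps => [|p ps IH] nps; first by exists 1%g.
have [|g gP] := IH; first by move=> q qs; apply: nps; rewrite inE qs orbT.
have [pg|npg] := pselect (commensurates (g^-1 * p * g)%g); last first.
  by exists g => q; rewrite inE => /orP[/eqP ->//|/gP].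
have [g1 pg1] := nps p (mem_head _ _).
set p' := (g^-1 * p * g)%g in pg; pose x := (g^-1 * g1)%g.
have px : ~ commensurates (x^-1 * p' * x)%g by rewrite /x /p' !gs.
have nx : ~ commensurates x.
  move=> xE; apply: px; apply: commensuratesM => //.
  by apply: commensuratesM => //; exact: commensuratesV.
have [N hN] : exists N : nat, forall n, (N < `|n|)%N -> forall q, q \in ps ->
    ~ commensurates (x^-1 * F (- n) * (g^-1 * q * g) * F n * x)%g.
  have [|N hN] := @commensurates_escape_seq [seq (g^-1 * q * g)%g | q <- ps] x _ nx.
    by move=> _ /mapP[q qs ->]; exact: gP.
  by exists N => n nN q qs; apply: hN => //; exact: map_f.
suff [n nN nn] : exists2 n, (N < `|n|)%N &
    ~ commensurates (x^-1 * F (- n) * p' * F n * x)%g.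
  exists (g * F n * x)%g => q; rewrite inE => /orP[/eqP ->|qs].
    by move: nn; rewrite /p' expgzN !gs.
  by have := hN _ nN _ qs; rewrite expgzN !gs.
clearbody p'; apply: contrapT => nex.
have bad n : (N < `|n|)%N -> commensurates (x^-1 * F (- n) * p' * F n * x)%g.
  by move=> nN; apply: contrapT => h; apply: nex; exists n.
pose phi (k : nat) := (F (- (k + N.+1)%:Z) * p' * F (k + N.+1)%:Z)%g.
(* Infinitely many distinct conjugates of [p'] contradict almost malnormality; otherwise two
   coincide and [p'] commutes with a nontrivial power of [f]. *)
have [phiI|nI] := pselect (injective phi).
  apply: nx; apply: (infinite_conj_commensurates phiI) => k.
    by apply: commensuratesM; [apply: commensuratesM => //|]; exact: commensurates_pow.
  by have := bad (k + N.+1)%:Z; rewrite /phi !mulgA; apply; lia.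
have [k [l [kl e]]] : exists k l, k <> l /\ phi k = phi l.
  apply: contrapT => h; apply: nI => k l e; apply: contrapT => kl.
  by apply: h; exists k, l.
have comm : (p' * F (l%:Z - k%:Z) = F (l%:Z - k%:Z) * p')%g.
  have -> : l%:Z - k%:Z = (l + N.+1)%:Z - (k + N.+1)%:Z by lia.
  rewrite expgzD expgzN; apply: (mulgI (F (l + N.+1)%:Z)^-1%g).
  apply: (mulIg (F (k + N.+1)%:Z)); rewrite !gs.
  by move: e; rewrite /phi !expgzN => ->.
apply: px.
(* At this multiple the conjugation by the power of [f] fixes [p'], while the exponent is larger
   than [N]. *)
have := bad ((l%:Z - k%:Z) * N.+1%:Z).
rewrite abszM absz_nat => /(_ ltac:(nia)).
have := expgz_intertwine N.+1%:Z comm; rewrite -expgzM => comm'.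
by rewrite expgzN -!mulgA (mulgA p') comm' !gs.
Qed.

(** The elements [g * F n * x] with [n] large all work, and the quotient of two of them is a
    conjugate of a nontrivial power of [f] by [x], outside the commensurator. *)
Lemma simultaneous_escape_seq (ps : seq G) :
  (forall p, p \in ps -> exists g, ~ commensurates (g^-1 * p * g)%g) ->
  exists psi : nat -> G,
    (forall i p, p \in ps -> ~ commensurates ((psi i)^-1 * p * psi i)%g) /\
    forall i j, i != j -> ~ commensurates ((psi i)^-1 * psi j)%g.
Proof.
move=> /simultaneous_escape[g gP]; have [x nx] := not_commensurated.
have [|N hN] := @commensurates_escape_seq [seq (g^-1 * q * g)%g | q <- ps] x _ nx.
  by move=> _ /mapP[q qs ->]; exact: gP.
exists (fun i => g * F (i + N.+1)%:Z * x)%g; split=> [i p pps|i j ij].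
  have := hN (i + N.+1)%:Z _ _ (map_f _ pps); rewrite expgzN !gs; apply; lia.
have -> : ((g * F (i + N.+1)%:Z * x)^-1 * (g * F (j + N.+1)%:Z * x) =
    x^-1 * F (j%:Z - i%:Z) * x)%g.
  have -> : j%:Z - i%:Z = - (i + N.+1)%:Z + (j + N.+1)%:Z by lia.
  by rewrite expgzD expgzN !gs.
by move=> /commensurates_conj_pow h; apply: nx; apply: h; lia.
Qed.

(** The intersection of the conjugates of the commensurator is finite by almost malnormality. It
    contains every finite normal subgroup, since an element of such a group has finitely many
    conjugates by powers of [f] and so commutes with a nontrivial power. *)
Lemma max_finite_normal_core p : ~ max_finite_normal G p ->
  exists g, ~ commensurates (g^-1 * p * g)%g.
Proof.
pose core := [set q | forall g, commensurates (g^-1 * q * g)%g].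
have core1 : core 1%g by move=> g; rewrite mulg1 mulVg; exact: commensurates1.
have coreB u v : core u -> core v -> core (u / v)%g.
  move=> hu hv g.
  have -> : (g^-1 * (u / v) * g = g^-1 * u * g * (g^-1 * v * g)^-1)%g by rewrite !gs.
  by apply: commensuratesM => //; exact: commensuratesV.
have core_fin : finite_set core.
  apply: contrapT => /infinite_injection[phi phiI phiC].
  have [g0 []] := not_commensurated.
  apply: (infinite_conj_commensurates phiI) => k; last exact: phiC.
  by have := phiC k 1%g; rewrite mulg1 invg1 mul1g.
have maxE : is_max_finite_normal core.
  split=> [|M [Msub Mfin Mnor] q Mq].
    split=> // [|g].
      split=> [|u v]; rewrite !inE//; exact: coreB.
    apply/seteqP; split=> [_ [q hq <-] h|q hq].
      by rewrite conjgE; have := hq (g * h)%g; rewrite !gs.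
    exists (q ^ g^-1)%g; last by rewrite conjgKV.
    by move=> h; rewrite conjgE; have := hq (g^-1 * h)%g; rewrite !gs.
  suff ME h : M h -> commensurates h.
    move=> g; apply: ME; rewrite -(Mnor g); exists q => //.
    by rewrite conjgE mulgA.
  move=> Mh; have [N hN] := finite_pigeonhole Mfin.
  have [|k [l [kl _ e]]] := hN (fun k => h ^ (F k%:Z))%g.
    by move=> k _; rewrite -(Mnor (F k%:Z)); exists h.
  exists (l%:Z - k%:Z), (l%:Z - k%:Z); split; first by lia.
  rewrite expgzD expgzN; apply: (mulgI (F l%:Z)^-1%g).
  apply: (mulIg (F k%:Z)); rewrite !gs.
  by move: e; rewrite !conjgE !mulgA => ->.
move=> np; apply: contrapT => h; apply: np.
(* Having exhibited a maximal finite normal subgroup, [xget] does not fall back on its default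
   value. *)
have [_ maxP] := xgetI [set 1%g] maxE; apply: maxP maxE.1 _ _ => g.
by apply: contrapT => ng; apply: h; exists g.
Qed.

(** * Choosing an axis and inserting an element of a conjugate of [H] *)

Definition projects_near D g x :=
  forall q, nearest (axis g) x q -> mdist q (pt g) <= D.

(* Of any two of the axes, a point can project far away from the base point
   of at most one (Behrstock inequality), so among three axes one serves for
   two given points. *)
Lemma good_axis (psi : nat -> G) :
  (forall i j, i != j -> ~ commensurates ((psi i)^-1 * psi j)%g) ->
  exists D, forall x y, exists2 i, (i < 3)%N &
    projects_near D (psi i) x /\ projects_near D (psi i) y.
Proof.
move=> indep; have [C0 _ _] := ctr.
have [B BP] : exists B, forall ij : nat * nat,
    ([set i | (i < 3)%N] `*` [set j | (j < 3)%N]) ij ->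
    ij.1 != ij.2 -> bounded_proj ((psi ij.1)^-1 * psi ij.2)%g B.
  apply: finite_uniform_bound; first exact: finite_setX.
    by move=> ij B B' BB h /h; exact: bounded_proj_le.
  move=> [i j] _ /=; have [->|ij] := eqVneq i j; first by exists 0.
  by have [B BP] := bounded_projP (indep _ _ ij); exists B.
pose D := B + 37 * C.
have good i j x : (i < 3)%N -> (j < 3)%N -> i != j ->
    projects_near D (psi i) x \/ projects_near D (psi j) x.
  move=> i3 j3 ij; apply: contrapT => /not_orP[].
  move=> /existsNP[q1 /not_implyP[xq1 /negP]]; rewrite -ltNge => h1.
  move=> /existsNP[q2 /not_implyP[xq2 /negP]]; rewrite -ltNge => h2.
  have [_ exi _] := contr_axis (psi i) ctr; have [_ exj _] := contr_axis (psi j) ctr.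
  have [r q2r] := exi q2; have [s q1s] := exj q1.
  have hr : mdist r (pt (psi i)) <= B.
    apply: (bounded_proj_at (BP (i, j) (conj i3 j3) ij) _ q2r).
    by rewrite /= mulgA mulgV mul1g; exact: xq2.1.
  have hs : mdist s (pt (psi j)) <= B.
    have ji : j != i by rewrite eq_sym.
    apply: (bounded_proj_at (BP (j, i) (conj j3 i3) ji) _ q1s).
    by rewrite /= mulgA mulgV mul1g; exact: xq1.1.
  have far : 6 * C < mdist q1 r.
    by have := metric_triangle q1 r (pt (psi i)); rewrite /D in h1; lra.
  have := behrstock Xg (contr_axis _ ctr) (contr_axis _ ctr) xq1 xq2 q2r q1s far.
  by have := metric_triangle q2 s (pt (psi j)); rewrite /D in h2; lra.
exists D => x y.
have [x0|x1] := @good 0%N 1%N x isT isT isT; have [y0|y1] := @good 0%N 1%N y isT isT isT.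
- by exists 0%N.
- have [x1|x2] := @good 1%N 2%N x isT isT isT; first by exists 1%N.
  have [y0|y2] := @good 0%N 2%N y isT isT isT; first by exists 0%N.
  by exists 2%N.
- have [x0|x2] := @good 0%N 2%N x isT isT isT; first by exists 0%N.
  have [y1|y2] := @good 1%N 2%N y isT isT isT; first by exists 1%N.
  by exists 2%N.
- by exists 1%N.
Qed.

(* The witness is [w = g F^m g^-1 p g F^-m g^-1], where [g] is chosen among
   three elements according to [y] and [z], and [p] is the element of [P]
   provided by confinement at [z^-1 g F^m g^-1]. *)
Lemma confined_insertion (H P : set G) : confining_subset H P ->
  (forall p, P p -> exists g, ~ commensurates (g^-1 * p * g)%g) ->
  exists2 D, 0 <= D & forall M, exists2 W : set G, finite_set W &
    forall y z, exists w, [/\ W w, M < len w, H (z^-1 * w * z)%g &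
      forall gamma L, 0 <= L -> geod gamma 0 L -> gamma 0 = o ->
        gamma L = pt (y * w * z)%g -> exists s t, [/\ 0 <= s, s <= t, t <= L,
          mdist (gamma s) (pt y) <= D & mdist (gamma t) (pt (y * w)%g) <= D]].
Proof.
move=> [Pfin conf] Pmoves; have [C0 _ _] := ctr.
have /finite_seqP[ps psE] := Pfin.
have [|psi [psiP indep]] := @simultaneous_escape_seq ps.
  by move=> p pps; apply: Pmoves; rewrite psE.
have [D DP] := good_axis indep.
have D0 : 0 <= D.
  have [i _ [h _]] := DP o o; have [_ ex _] := contr_axis (psi i) ctr.
  by have [q oq] := ex o; apply: le_trans (h _ oq); exact: mdist_ge0.
have [B BP] : exists B, forall ip : nat * G, ([set i | (i < 3)%N] `*` P) ip ->
    bounded_proj ((psi ip.1)^-1 * ip.2 * psi ip.1)%g B /\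
    bounded_proj ((psi ip.1)^-1 * ip.2^-1 * psi ip.1)%g B.
  apply: finite_uniform_bound; first exact: finite_setX.
    by move=> ip B B' BB [h1 h2]; split; apply: bounded_proj_le BB _.
  move=> [i p] [_ /=]; rewrite psE => pps.
  have np := psiP i _ pps.
  have np' : ~ commensurates ((psi i)^-1 * p^-1 * psi i)%g.
    by move=> /commensuratesV; rewrite !gs.
  have [B1 b1] := bounded_projP np; have [B2 b2] := bounded_projP np'.
  exists (Num.max B1 B2); split; [apply: bounded_proj_le b1|apply: bounded_proj_le b2].
    by rewrite le_max lexx.
  by rewrite le_max lexx orbT.
pose lam := len (psi 0%N) + len (psi 1%N) + len (psi 2%N).
have lamP i : (i < 3)%N -> len (psi i) <= lam.
  have h k : 0 <= len (psi k) by exact: mdist_ge0.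
  have := (h 0%N, h 1%N, h 2%N); rewrite /lam.
  by case: i => [|[|[|//]]] h' _; case: h' => -[] *; lra.
have lam0 : 0 <= lam by apply: le_trans (lamP 0%N isT); exact: mdist_ge0.
exists (9 * C + D + lam); first lra.
(* The terms [5 * D + 80 * C] serve [detour_both]. The rest forces [M < len w]: by [nearest_lip],
   [l] is at most [4 * (len w + 2 * lam)] plus [C] and the projection bound. *)
move=> M; pose l := `|B| + 5 * D + 80 * C + 4 * (`|M| + 2 * lam) + C + 1.
have [N hN] := fproper l; pose m := N.+1%:Z.
have lm : l < len (F m) by rewrite ltNge; apply/negP => /hN; rewrite absz_nat ltnn.
exists [set (psi ip.1 * F m * (psi ip.1)^-1 * ip.2 * psi ip.1 * F (- m) * (psi ip.1)^-1)%g
  | ip in [set i | (i < 3)%N] `*` P].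
  by apply: finite_image; apply: finite_setX.
(* After translation by [y^-1], the geodesic to be studied runs from [y^-1 o] to [w z o]. *)
move=> y z; have [i i3 [near_y near_z]] := DP (pt y^-1%g) (pt z).
set g := psi i in near_y near_z.
have [p [[h Hh hp] [Pp _]]] := conf (z^-1 * g * F m * g^-1)%g.
have [b1 b2] := BP (i, p) (conj i3 Pp); rewrite /= -/g in b1 b2.
have lg := lamP _ i3; rewrite -/g in lg.
pose w := (g * F m * g^-1 * p * g * F (- m) * g^-1)%g.
(* Seen from [g * F m], the axes of [g] and [w * g] become [axis 1] and the axis of [g^-1 * p * g],
   between which projections are bounded. *)
have wg : (w * g * F m = g * F m * (g^-1 * p * g))%g by rewrite /w expgzN !gs.
have wV : (w * g * F m * (g^-1 * p^-1 * g) = g * F m)%g by rewrite wg !gs.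
have MM := ler_norm M; have BB := ler_norm B.
have M0 := normr_ge0 M; have B0 := normr_ge0 B.
pose Z1 := axis g; pose Z2 := axis (w * g)%g.
have B1 u q : Z2 u -> nearest Z1 u q -> mdist q (pt (g * F m)%g) <= `|B|.
  move=> Z2u uq; apply: le_trans BB; apply: (bounded_proj_at b1 (u := u)).
    by rewrite -wg axis_shift.
  by rewrite axis_shift.
have B2 u q : Z1 u -> nearest Z2 u q -> mdist q (pt (w * g * F m)%g) <= `|B|.
  move=> Z1u uq; apply: le_trans BB; apply: (bounded_proj_at b2 (u := u)).
    by rewrite wV axis_shift.
  by rewrite axis_shift.
have ee : l <= mdist (pt g) (pt (g * F m)%g) by rewrite mdist_pt !gs ltW.
have kk : l <= mdist (pt (w * g)%g) (pt (w * g * F m)%g) by rewrite mdist_pt !gs ltW.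
exists w; split.
- by exists (i, p).
- have [_ ex _] := contr_axis g ctr; have [q wq] := ex (pt (w * g)%g).
  have := nearest_lip (contr_axis g ctr) (nearest_self (axis_base g)) wq.
  have := B1 _ _ (axis_base (w * g)%g) wq.
  have := metric_triangle (pt g) q (pt (g * F m)%g).
  have := metric_triangle (pt g) o (pt (w * g)%g).
  have := metric_triangle o (pt w) (pt (w * g)%g).
  rewrite (mdist_pt w) mulKg (metric_sym (pt g) o).
  by rewrite /l in ee; lra.
- have -> : (z^-1 * w * z = h)%g; last by [].
  by rewrite /w -hp conjgE expgzN !gs.
clearbody w => gamma L L0 ge g0 gL.
pose gamma' t := act y^-1%g (gamma t).
have ge' : geod gamma' 0 L by move=> s t *; rewrite mdist_act ge.
have [|a|b|s [t [s0 st tL hs ht]]] := detour_both Xg (contr_axis g ctr)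
    (contr_axis (w * g)%g ctr) (axis_base _) (axis_base _) B1 B2 ee kk _ L0 ge' (D := D).
- by rewrite /l; lra.
- by rewrite /gamma' g0; exact: near_y.
- rewrite /gamma' gL -actM !gs (actM w) => /nearest_actV.
  rewrite -!actM !gs => /near_z.
  by rewrite -(mdist_act w) -!actM !gs act1.
exists s, t; split=> //.
  have := metric_triangle (gamma s) (pt (y * g)%g) (pt y).
  rewrite mdist_pt !gs lenV -(mdist_act y^-1%g _ (pt (y * g)%g)) -actM !gs.
  by rewrite -/(gamma' s); lra.
have := metric_triangle (gamma t) (pt (y * w * g)%g) (pt (y * w)%g).
rewrite mdist_pt !gs lenV -(mdist_act y^-1%g _ (pt (y * w * g)%g)) -actM !gs.
by rewrite -/(gamma' t); lra.
Qed.
End Action.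

(** * Counting shortest coset representatives *)

Lemma card_set_sub (T : choiceType) (A B : set T) :
  finite_set B -> A `<=` B -> (card_set A <= card_set B)%N.
Proof.
move=> Bfin AB; apply: fsubset_leq_card.
by rewrite -fset_set_sub//; exact: sub_finite_set AB Bfin.
Qed.

Section Counting.
Context {R : realType} {X : metricType R} {G : groupType}.
Variables (act : G -> X -> X) (o : X) (H : set G).
Implicit Types (g h w y z : G) (n : nat) (r : R).

Local Notation pt g := (act g o).
Local Notation len g := (mdist o (act g o)).
Let gs := (@invgM G, @invgK G, @mulgA G, @mulgK G, @mulgVK G, @mulgV G,
  @mulVg G, @mul1g G, @mulg1 G, @invg1 G).

Hypothesis iso : isometric_action act.
Hypothesis finball : forall r, finite_set [set g | len g <= r].
Hypothesis Xg : geodesic_space X.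
Hypothesis Hsub : is_subgroup H.

Lemma subgroup_inv h : H h -> H h^-1%g.
Proof. by move=> Hh; have := group_closedV Hsub (mem_set Hh); rewrite inE. Qed.

Lemma subgroup_mul h h' : H h -> H h' -> H (h * h')%g.
Proof.
move=> Hh Hh'.
by have := group_closedM Hsub (mem_set Hh) (mem_set Hh'); rewrite inE.
Qed.

Definition shortest z := forall h, H h -> len z <= len (z * h)%g.

(** A coset has a shortest element because balls are finite. Its length is a lower bound for the
    orbit of the coset, so it does not exceed the infimum [dist_set]. *)
Lemma card_cosets_le n : (card_set (ballGH act o H n) <=
  card_set ([set z | shortest z] `&` ballG act o n))%N.
Proof.
have H1 : H 1%g by case: Hsub; rewrite inE.
have fin : finite_set ([set z | shortest z] `&` ballG act o n).
  exact/finite_setIr/finball.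
apply: (@leq_trans (card_set [set left_coset H z | z in
    [set z | shortest z] `&` ballG act o n])); last first.
  by rewrite /card_set fset_set_image//; exact: leq_imfset_card.
apply: card_set_sub; first exact: finite_image.
move=> _ [g /= gn <-].
have g0 : left_coset H g !=set0 by exists (g * 1)%g, 1%g.
have [|z gz zmin] := finite_argmin (h := fun z => len z) g0.
  by move=> r; exact/finite_setIr/finball.
have [h Hh hz] := gz.
exists z; last first.
  apply/seteqP; split=> _ [k Hk <-].
    by exists (h * k)%g; [exact: subgroup_mul|rewrite mulgA hz].
  exists (h^-1 * k)%g; last by rewrite -hz !gs.
  by apply: subgroup_mul => //; exact: subgroup_inv.
split=> /= [k Hk|].
  by apply: zmin; exists (h * k)%g; [exact: subgroup_mul|rewrite mulgA hz].
apply: le_trans gn; apply: lb_le_inf.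
  by exists (len g), (pt g) => //; exists g => //; exists 1%g; rewrite ?mulg1.
by move=> _ [_ [k gk <-] <-]; exact: zmin.
Qed.

(** * Multiplicity of the insertion map *)

Variables (D : R) (W : set G).
Hypothesis Wfin : finite_set W.
Hypothesis insertion : forall y z, exists w, [/\ W w, 6 * D < len w,
  H (z^-1 * w * z)%g & forall gamma L, 0 <= L -> geod gamma 0 L ->
    gamma 0 = o -> gamma L = pt (y * w * z)%g -> exists s t,
    [/\ 0 <= s, s <= t, t <= L, mdist (gamma s) (pt y) <= D &
        mdist (gamma t) (pt (y * w)%g) <= D]].

(* If the tail [z'] of [x] were much longer than the tail [z], then [z'] would
   contain the segment [w], and [z'] could be shortened within its coset by
   deleting [w], as [z^-1 * w * z] lies in [H]. *)
Lemma tails_close gamma L lw x y z w y' z' w' (s t t' : R) :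
  geod gamma 0 L -> gamma L = pt x -> x = (y * w * z)%g ->
  x = (y' * w' * z')%g -> len w <= lw -> 6 * D < len w ->
  H (z^-1 * w * z)%g -> shortest z' ->
  0 <= s -> s <= t -> t <= L -> mdist (gamma s) (pt y) <= D ->
  mdist (gamma t) (pt (y * w)%g) <= D ->
  0 <= t' -> t' <= t -> mdist (gamma t') (pt (y' * w')%g) <= D ->
  mdist (pt (y * w)%g) (pt (y' * w')%g) <= lw + 4 * D.
Proof.
move=> ge gL xE xE' wlw wD Hw sz' s0 st tL hs ht t'0 t't ht'.
have gst := ge s t s0 st tL.
have [h|h] := leP s t'.
  have := metric_triangle (gamma s) (pt y) (gamma t).
  have := metric_triangle (pt y) (pt (y * w)%g) (gamma t).
  have := metric_triangle (pt (y * w)%g) (gamma t) (pt (y' * w')%g).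
  have := metric_triangle (gamma t) (gamma t') (pt (y' * w')%g).
  rewrite (metric_sym (gamma t) (gamma t')) (ge t' t) // (metric_sym (pt (y * w)%g) (gamma t)).
  rewrite (mdist_pt o iso y) mulKg; lra.
(* Here [t' < s]. Deleting [w] from [z' = c * w * z] stays in the coset, so minimality of [z'] gives
   [t - s <= 4 * D], hence [len w <= 6 * D], a contradiction. *)
pose c := ((y' * w')^-1 * y)%g.
have z'E : z' = (c * w * z)%g.
  by apply: (mulgI (y' * w')%g); rewrite -xE' xE /c !gs.
have : len z' <= len c + len z.
  apply: le_trans (lenM o iso c z); have := sz' _ (subgroup_inv Hw).
  by rewrite z'E !gs.
have lc : mdist (pt (y' * w')%g) (pt y) = len c by rewrite mdist_pt.
have lz' : mdist (pt (y' * w')%g) (gamma L) = len z'.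
  by rewrite gL xE' mdist_pt// mulKg.
have lz : mdist (pt (y * w)%g) (gamma L) = len z.
  by rewrite gL xE mdist_pt// mulKg.
have lw' : mdist (pt y) (pt (y * w)%g) = len w by rewrite mdist_pt// mulKg.
have := metric_triangle (gamma t') (pt (y' * w')%g) (gamma L).
have := metric_triangle (pt (y' * w')%g) (gamma t') (pt y).
have := metric_triangle (gamma t') (gamma s) (pt y).
have := metric_triangle (pt y) (gamma s) (pt (y * w)%g).
have := metric_triangle (gamma s) (gamma t) (pt (y * w)%g).
have := metric_triangle (pt (y * w)%g) (gamma t) (gamma L).
rewrite lc lz lz' lw' gst (ge t' L) ?(ge t' s) ?(ge t L)//; [|lra..].
rewrite (metric_sym (pt (y' * w')%g)) (metric_sym (pt y)) (metric_sym (pt (y * w)%g)).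
lra.
Qed.

(** Both factorisations are followed along one geodesic from [o] to their common value, and the one
    whose inserted element ends later takes the unprimed role in [tails_close]. *)
Lemma insertion_shortest : exists ins : G -> G -> G, exists2 r,
  (forall y z, W (ins y z)) &
  (forall y z y' z', shortest z -> shortest z' ->
    (y * ins y z * z = y' * ins y' z' * z')%g -> len (z' * z^-1)%g <= r).
Proof.
have /choice[ins' ins'P] := fun yz : G * G => insertion yz.1 yz.2.
pose ins y z := ins' (y, z); have insP y z := ins'P (y, z).
have [lw lwP] : exists lw, forall w, W w -> len w <= lw.
  apply: finite_uniform_bound Wfin _ _ => [w B B' /[swap]|w _].
    exact: le_trans.
  by exists (len w).
exists ins, (lw + 4 * D) => [y z|y z y' z' zs zs' e]; first by case: (insP y z).
set x := (y * ins y z * z)%g in e.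
have [gamma [g0 g1 ge]] := geod_ex Xg o (pt x).
have L0 := mdist_ge0 o (pt x); set L := mdist o (pt x) in g1 ge L0.
have [Ww lw6 Hw /(_ gamma L L0 ge g0 g1)] := insP y z.
have [Ww' lw6' Hw' /(_ gamma L L0 ge g0)] := insP y' z'.
rewrite /= -/(ins y z) -/(ins y' z') in Ww lw6 Hw Ww' lw6' Hw' *.
rewrite -e => /(_ g1)[s' [t' [s'0 st' t'L hs' ht']]] [s [t [s0 st tL hs ht]]].
have -> : (z' * z^-1 = (y' * ins y' z')^-1 * (y * ins y z))%g.
  apply: (mulgI (y' * ins y' z')%g); apply: (mulIg z).
  by rewrite !gs -e.
rewrite -(mdist_pt o iso).
have [tt'|/ltW tt'] := leP t' t.
  rewrite metric_sym.
  by apply: (tails_close ge g1 erefl e (lwP _ Ww) lw6 Hw zs' s0 st tL hs ht _ tt' ht');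
    exact: le_trans st'.
by apply: (tails_close ge g1 e erefl (lwP _ Ww') lw6' Hw' zs s'0 st' t'L hs' ht' _ tt' ht);
  exact: le_trans st.
Qed.

(* [(y, z) |-> y * ins y z * z] is boundedly-many-to-one on shortest [z]. *)
Lemma card_pairs_le : exists K M : nat, forall n (s : seq (G * G)), uniq s ->
  (forall p, p \in s -> shortest p.2 /\ len p.1 + len p.2 <= n%:R) ->
  (size s <= card_set (ballG act o (n + M)) * K)%N.
Proof.
have [ins [r insW insP]] := insertion_shortest.
have [lw lwP] : exists lw, forall w, W w -> len w <= lw.
  apply: finite_uniform_bound Wfin _ _ => [w B B' /[swap]|w _].
    exact: le_trans.
  by exists (len w).
pose Phi (p : G * G) := (p.1 * ins p.1 p.2 * p.2)%g.
(* A reference tail is fixed for each value of [Phi]; all other tails with that value differ from it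
   by an element of the ball of radius [r]. *)
have /choice[tail tailP] : forall x, exists z0, forall p, shortest p.2 ->
    Phi p = x -> len (p.2 * z0^-1)%g <= r.
  move=> x; have [[p0 [sp0 Px0]]|nP] := pselect (exists p, shortest p.2 /\ Phi p = x).
    by exists p0.2 => p sp Px; apply: (insP p0.1 p0.2 p.1 p.2) => //; rewrite [LHS]Px0 -Px.
  by exists 1%g => p sp Px; case: nP; exists p.
pose code p := (Phi p, ((p.2 * (tail (Phi p))^-1)%g, ins p.1 p.2)).
have codeI : injective code.
  move=> [y z] [y' z'] [/= e1]; rewrite e1 => /mulIg zz; rewrite -zz => ww.
  by move: e1; rewrite /Phi /= -zz ww => /mulIg/mulIg ->.
pose M := (Num.truncn lw).+1; pose Br := fset_set [set g | len g <= r].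
exists (size (enum_fset Br) * size (enum_fset (fset_set W)))%N, M => n s us sP.
pose target := [seq (x, q) | x <- enum_fset (fset_set (ballG act o (n + M))),
  q <- [seq (a, b) | a <- enum_fset Br, b <- enum_fset (fset_set W)]].
have -> : (card_set (ballG act o (n + M)) *
    (size (enum_fset Br) * size (enum_fset (fset_set W))))%N = size target.
  by rewrite /target !size_allpairs.
rewrite -(size_map code); apply: uniq_leq_size; first by rewrite map_inj_uniq.
move=> _ /mapP[p ps ->]; have [sp np] := sP _ ps.
apply: allpairs_f; last apply: allpairs_f.
- rewrite in_fset_set; last exact: finball.
  rewrite inE /ballG /= natrD; apply: le_trans (lenM o iso _ _) _.
  have := lenM o iso p.1 (ins p.1 p.2); have := lwP _ (insW p.1 p.2).
  have := truncnS_gt lw; rewrite -/M => h1 h2 h3; lra.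
- rewrite in_fset_set; last exact: finball.
  by rewrite inE /=; exact: tailP.
- by rewrite in_fset_set// inE; exact: insW.
Qed.

Definition short_ball n := fset_set ([set z | shortest z] `&` ballG act o n).

Lemma in_short_ball n z : (z \in short_ball n) = `[< shortest z /\ len z <= n%:R >].
Proof.
rewrite in_fset_set; last exact/finite_setIr/finball.
by apply/idP/asboolP; rewrite inE.
Qed.

Lemma convolution_le : exists K M : nat, forall n,
  (\sum_(z <- short_ball n) card_set (ballG act o (n - (Num.truncn (len z)).+1)) <=
   card_set (ballG act o (n + M)) * K)%N.
Proof.
have [K [M KM]] := card_pairs_le; exists K, M => n.
pose s := [seq (y, z) | z <- enum_fset (short_ball n),
  y <- enum_fset (fset_set (ballG act o (n - (Num.truncn (len z)).+1)))].
have -> : (\sum_(z <- short_ball n) card_set (ballG act o (n - (Num.truncn (len z)).+1)) =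
    size s)%N.
  by rewrite /s size_allpairs_dep sumnE big_map.
apply: KM.
  apply: allpairs_uniq_dep => [|z _|]; [exact: fset_uniq..|].
  by move=> [z y] [z' y'] _ _ [-> ->].
move=> _ /allpairsPdep[z [y [zs ys ->]]] /=.
move: zs; rewrite in_short_ball => /asboolP[zs zn]; split=> //.
move: ys; rewrite in_fset_set; last exact: finball.
rewrite inE /ballG /= => yn.
have tz := truncnS_gt (len z).
have [h|h] := leqP (Num.truncn (len z)).+1 n.
  by rewrite natrB// in yn; lra.
(* The truncated subtraction gives radius 0, so [len y <= 0] and the pair is still admissible. *)
by move: yn; rewrite (eqP (_ : (n - _ == 0)%N)) ?subn_eq0 1?ltnW// => yn; lra.
Qed.

(** * Consequences of purely exponential growth *)

Variables (c omega : R).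
Hypothesis c1 : 1 <= c.
Hypothesis growth : forall n, (1 <= n)%N ->
  c^-1 * expR (n%:R * omega) <= (card_set (ballG act o n))%:R <=
    c * expR (n%:R * omega).

(** With a nonpositive exponent all balls would have at most [c] elements, which is impossible in an
    infinite group. *)
Lemma growth_gt0 : ~ finite_set [set: G] -> 0 < omega.
Proof.
move=> infG; rewrite ltNge; apply/negP => omega0.
have [S _ Sc] := infinite_set_fset (Num.truncn c).+1 infG.
have [r rP] : exists r, forall g, [set` S] g -> len g <= r.
  apply: finite_uniform_bound => [|g B B' /[swap]|g _]; first exact: finite_fset.
    exact: le_trans.
  by exists (len g).
pose n := (Num.truncn r).+1; have rn := truncnS_gt r.
have : (#|` S| <= card_set (ballG act o n))%N.
  rewrite -[S in (#|` S|)]set_fsetK; apply: card_set_sub; first exact: finball.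
  by move=> g /rP gr; apply: le_trans gr _; exact: ltW.
move=> /(leq_trans Sc); apply/negP; rewrite -ltnNge -(ltr_nat R).
apply: le_lt_trans (truncnS_gt c).
have /andP[_ /le_trans] := growth (isT : (1 <= n)%N); apply.
apply: ler_piMr; first exact: le_trans ler01 c1.
by rewrite expR_le1 mulr_ge0_le0.
Qed.

Hypothesis omega0 : 0 < omega.

(** The lower growth bound for each ball in [convolution_le] and the upper bound for the ball of
    radius [n + M] share the factor [expR (omega * n)], which cancels. *)
Lemma expR_weight_le : exists B, forall n, (1 <= n)%N ->
  \sum_(z <- short_ball n) expR (- (omega * (Num.truncn (len z)).+1%:R)) <= B.
Proof.
have [K [M KM]] := convolution_le.
have c0 : 0 < c := lt_le_trans ltr01 c1.
have ci : 0 < c^-1 by rewrite invr_gt0.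
exists (c * (K%:R * (c * expR (omega * M%:R)))) => n n1.
set S := \sum_(z <- _) _.
(* For [n <= m] the ball has radius 0 and contains 1, while the left side is at most 1. *)
have low m : c^-1 * expR (omega * (n%:R - m%:R)) <= (card_set (ballG act o (n - m)))%:R.
  have [h|h] := ltnP m n.
    have nm : (0 < n - m)%N by rewrite subn_gt0.
    by have /andP[+ _] := growth nm; rewrite natrB 1?ltnW// (mulrC omega).
  have -> : (n - m = 0)%N by apply/eqP; rewrite subn_eq0.
  apply: (@le_trans _ _ 1).
    rewrite -[leRHS]mulr1; apply: ler_pM; rewrite ?expR_ge0 ?(ltW ci) ?invf_le1//.
    by rewrite expR_le1 pmulr_rle0// subr_le0 ler_nat.
  rewrite ler1n /card_set cardfs_gt0; apply/fset0Pn; exists 1%g.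
  rewrite in_fset_set; last exact: finball.
  by rewrite inE /ballG /= act1// mdistxx.
have : c^-1 * expR (omega * n%:R) * S <=
    (card_set (ballG act o (n + M)))%:R * K%:R.
  have := KM n; rewrite -(ler_nat R) natrM; apply: le_trans.
  rewrite natr_sum /S mulr_sumr; apply: ler_sum => z _.
  apply: le_trans (low _).
  by rewrite -mulrA -expRD mulrBr.
have /andP[_ up] := growth (leq_trans n1 (leq_addr M n)).
have K0 : 0 <= K%:R :> R by [].
move=> /le_trans /(_ (ler_wpM2r K0 up)).
rewrite natrD mulrDl expRD (mulrC n%:R) (mulrC M%:R) => h.
rewrite -(ler_pM2l (_ : 0 < c^-1 * expR (omega * n%:R))); last first.
  by rewrite mulr_gt0// expR_gt0.
apply: le_trans h _.
rewrite le_eqVlt; apply/orP; left; apply/eqP.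
have c_neq0 : c != 0 by rewrite gt_eqF.
by field.
Qed.

Lemma short_ball_sub m n : (m <= n)%N -> (short_ball m `<=` short_ball n)%fset.
Proof.
move=> mn; apply/fsubsetP => z; rewrite !in_short_ball => /asboolP[sz zm].
by apply/asboolP; split=> //; apply: le_trans zm _; rewrite ler_nat.
Qed.

(** Beyond [short_ball N] the total weight is at most [d], while each element of [short_ball n]
    weighs at least [expR (- (omega * n.+1))], which bounds their number; the fixed set
    [short_ball N] is absorbed by exponential growth. *)
Lemma short_ball_negligible (e : R) : 0 < e ->
  exists N : nat, forall n, (N <= n)%N ->
    (#|` short_ball n|)%:R <= e * (card_set (ballG act o n))%:R.
Proof.
move=> e0; have [B BP] := expR_weight_le.
have c0 : 0 < c := lt_le_trans ltr01 c1.
pose wt z := expR (- (omega * (Num.truncn (len z)).+1%:R)).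
pose S n := \sum_(z <- short_ball n) wt z.
(* Chosen so that [expR (omega * n.+1) * d] is [e / 2] times the lower bound for the ball. *)
pose d := e / (2 * c * expR omega).
have d0 : 0 < d by rewrite divr_gt0// !mulr_gt0// expR_gt0.
have supS : has_sup [set S n | n in [set n | (1 <= n)%N]].
  by split; [exists (S 1%N), 1%N|exists B => _ [n n1 <-]; exact: BP].
have [_ [N N1 <-] SN] := sup_adherent d0 supS.
pose A := (#|` short_ball N|)%:R : R.
(* From [N'] on, [expR x >= 1 + x] makes [A] at most the other half. *)
pose N' := (Num.truncn (2 * A * c / (e * omega))).+1.
exists (maxn N N') => n; rewrite geq_max => /andP[Nn N'n].
have n1 : (1 <= n)%N by apply: leq_trans Nn.
have perm : perm_eq (short_ball n) (enum_fset (short_ball N) ++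
    enum_fset (short_ball n `\` short_ball N)%fset).
  apply: uniq_perm; first exact: fset_uniq.
    rewrite cat_uniq !fset_uniq /= andbT; apply/hasPn => z.
    by rewrite in_fsetD => /andP[].
  move=> z; rewrite mem_cat in_fsetD.
  by have := fsubsetP (short_ball_sub Nn) z; case: (z \in short_ball N) => // ->.
have Sn : S n <= sup [set S n | n in [set n | (1 <= n)%N]].
  by apply: ub_le_sup; [case: supS|exists n].
have {Sn SN} : \sum_(z <- (short_ball n `\` short_ball N)%fset) wt z <= d.
  move: Sn; rewrite {1}/S (perm_big _ perm) big_cat /= -/(S N); lra.
have -> : (#|` short_ball n|)%:R =
    A + \sum_(z <- (short_ball n `\` short_ball N)%fset) 1 :> R.
  by rewrite (perm_size perm) size_cat natrD big_const_seq count_predT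
    iter_addr_0.
move=> hd.
have hsum : \sum_(z <- (short_ball n `\` short_ball N)%fset) 1 <=
    expR (omega * n.+1%:R) * d :> R.
  apply: le_trans (ler_wpM2l (expR_ge0 _) hd); rewrite mulr_sumr.
  rewrite big_seq [leRHS]big_seq; apply: ler_sum => z.
  rewrite in_fsetD => /andP[_]; rewrite in_short_ball => /asboolP[_ zn].
  rewrite /wt -expRD -mulrBr -[leLHS]expR0 ler_expR pmulr_rge0// subr_ge0 ler_nat ltnS.
  by rewrite -(@ler_nat R); apply: le_trans zn; rewrite truncn_le mdist_ge0.
have /andP[low _] := growth n1.
apply: (@le_trans _ _ (e * (c^-1 * expR (n%:R * omega)))); last by rewrite ler_pM2l.
have h1 : expR (omega * n.+1%:R) * d = e / 2 * (c^-1 * expR (n%:R * omega)).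
  rewrite -natr1 mulrDr mulr1 expRD (mulrC omega) /d.
  have c_neq0 : c != 0 by rewrite gt_eqF.
  have E0 : expR omega != 0 by rewrite expR_eq0.
  by field; rewrite c_neq0 E0.
have h2 : A <= e / 2 * (c^-1 * expR (n%:R * omega)).
  have hn : 2 * A * c / (e * omega) <= n%:R.
    by apply: le_trans (ltW (truncnS_gt _)) _; rewrite ler_nat.
  have hE := expR_ge1Dx (n%:R * omega).
  rewrite ler_pdivrMr ?mulr_gt0// in hn.
  have -> : e / 2 * (c^-1 * expR (n%:R * omega)) = e * expR (n%:R * omega) / (2 * c).
    have c_neq0 : c != 0 by rewrite gt_eqF.
    by field.
  rewrite ler_pdivlMr ?mulr_gt0//.
  apply: (@le_trans _ _ (e * (1 + n%:R * omega))); last by rewrite ler_pM2l.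
  lra.
lra.
Qed.

End Counting.

(** * Proper actions and quasi-geodesics *)

Section Setting.
Context {R : realType} {X : metricType R} {G : groupType}.
Variables (act : G -> X -> X) (o : X) (f : G).

Hypothesis iso : isometric_action act.
Hypothesis Xproper : proper_space X.
Hypothesis act_proper : proper_action act.

Lemma finite_orbit_ball (r : R) : finite_set [set g | mdist o (act g o) <= r].
Proof.
(* The radius is made nonnegative so that the compact ball contains [o]. *)
have := act_proper (@Xproper o (Num.max r 0)); apply: sub_finite_set => g /= gr.
exists (act g o); split=> /=; last by rewrite le_max gr.
by exists o => //=; rewrite mdistxx le_max lexx orbT.
Qed.

Hypothesis fqg : quasi_geodesic (fun n : int => act (expgz f n) o).

Lemma quasi_geodesic_proper (r : R) : exists N : nat, forall n : int,
  mdist o (act (expgz f n) o) <= r -> (`|n| <= N)%N.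
Proof.
have [lam [c [lam1 c0 qg]]] := fqg.
have lam0 : 0 < lam := lt_le_trans ltr01 lam1.
exists (Num.truncn (lam * (r + c))).+1 => n nr.
have /andP[+ _] := qg 0 n; rewrite act1// sub0r normrN => h.
rewrite -(ler_nat R); apply: le_trans (ltW (truncnS_gt _)).
rewrite -ler_pdivrMl// natr_absz; lra.
Qed.

(** A quasi-geodesic has finitely many indices in a ball, so the infimum [dist_set] is attained and
    the diameter bound can be read off on nearest points. *)
Lemma contracting_axis C :
  contracting_set C (range (fun n : int => act (expgz f n) o)) ->
  contr C (axis act o f 1%g).
Proof.
move=> [_ C0 cc].
have rangeE : range (fun n : int => act (expgz f n) o) = axis act o f 1%g.
  by apply/seteqP; split=> _ [n _ <-]; exists n; rewrite ?mul1g.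
rewrite rangeE in cc.
have distE x q : nearest (axis act o f 1%g) x q ->
    dist_set x (axis act o f 1%g) = mdist x q.
  move=> [Aq xq]; apply/eqP; rewrite eq_le; apply/andP; split.
    apply: ge_inf; last by exists q.
    by exists 0 => _ [z _ <-]; exact: mdist_ge0.
  apply: lb_le_inf; first by exists (mdist x q), q.
  by move=> _ [z Az <-]; exact: xq.
split=> // [x|x y q r xq yr].
  have [||n _ nmin] := @finite_argmin R int setT (fun n => mdist x (act (expgz f n) o)).
  - by exists 0.
  - move=> r; have [N hN] := quasi_geodesic_proper (mdist o x + r).
    pose I := iota 0 N.+1; pose s := [seq k%:Z | k <- I] ++ [seq - k%:Z | k <- I].
    apply: (@sub_finite_set _ _ [set` s]); last exact: finite_seq.
    move=> n [_ nr]; have nN : (`|n| <= N)%N.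
      by apply: hN; apply: le_trans (metric_triangle o x _) _; rewrite lerD2l.
    suff : n \in s by []; rewrite mem_cat; apply/orP.
    have [n0|/ltW n0] := leP 0 n; [left|right].
      by apply/mapP; exists `|n|%N; [rewrite mem_iota|rewrite gez0_abs].
    by apply/mapP; exists `|n|%N; [rewrite mem_iota|rewrite lez0_abs// opprK].
  exists (act (expgz f n) o); split; first by exists n; rewrite ?mul1g.
  by move=> _ [m _ <-]; rewrite mul1g; exact: nmin.
rewrite -(distE _ _ xq) => /cc; rewrite -lee_fin; apply: le_trans.
apply: ereal_sup_ubound; exists q; first by left; split; [case: xq|rewrite (distE _ _ xq)].
by exists r => //; right; split; [case: yr|rewrite (distE _ _ yr)].
Qed.

End Setting.

Lemma commensurates_virtually_Z (R : realType) (X : metricType R) (G : groupType)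
    (act : G -> X -> X) (o : X) (f : G) (C : R) :
  isometric_action act -> (forall r, finite_set [set g | mdist o (act g o) <= r]) ->
  (forall r, exists N : nat, forall n : int, mdist o (act (expgz f n) o) <= r ->
    (`|n| <= N)%N) ->
  contr C (axis act o f 1%g) -> geodesic_space X ->
  (forall g, commensurates f g) -> virtually_Z G.
Proof.
move=> iso finball fproper ctr Xg all; exists (range (expgz f)); split.
- split; first by rewrite inE; exists 0.
  move=> u v; rewrite !inE => -[m _ <-] [n _ <-].
  by exists (m - n) => //; rewrite expgzD expgzN.
- have [S [Sfin SP]] := commensurates_cosets iso finball fproper ctr Xg.
  apply: (sub_finite_set _ (finite_image (fun s => left_coset (range (expgz f)) s^-1%g) Sfin)).
  (* [commensurates_cosets] puts the power of [f] on the left; applying it to [g^-1] yields left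
     cosets. *)
  move=> _ [g _ <-]; have [n [s Ss gs]] := SP _ (all g^-1%g).
  exists s => //; have -> : g = (s^-1 * expgz f (- n))%g.
    by rewrite -[g]invgK gs invgM expgzN.
  apply/seteqP; split=> _ [_ [m _ <-] <-].
    by exists (expgz f (n + m)); [exists (n + m)|rewrite expgzD expgzN !mulgA mulgVK].
  by exists (expgz f (- n + m)); [exists (- n + m)|rewrite expgzD !mulgA].
- exists (expgz f); split=> //; last by move=> m n; rewrite expgzD.
  exact: expgz_inj iso fproper.
Qed.

Theorem theorem1p7 (R : realType) (X : metricType R) (G : groupType)
    (act : G -> X -> X) (o : X) (H P : set G)
    (X_proper : proper_space X) (X_geodesic : geodesic_space X)
    (G_non_elementary : non_elementary G)
    (act_isometric : isometric_action act) (act_proper : proper_action act)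
    (growth_finite : growth_rate act o \is a fin_num)
    (growth_pure : purely_exponential_growth act o)
    (G_contracting : exists h : G, contracting_element act o h)
    (H_subgroup : is_subgroup H) (H_nontrivial : H <> [set 1%g])
    (P_confining : confining_subset H P) (P_non_degenerate : non_degenerate P) :
  (card_set (ballGH act o H n))%:R / (card_set (ballG act o n))%:R @[n --> \oo]
    --> (0 : R).
Proof.
have [f [fqg [C /(contracting_axis act_isometric fqg) ctr]]] := G_contracting.
have finball := finite_orbit_ball o X_proper act_proper.
have fproper := quasi_geodesic_proper act_isometric fqg.
have nc : exists g, ~ commensurates f g.
  apply: contrapT => h; apply: G_non_elementary.2.
  apply: commensurates_virtually_Z act_isometric finball fproper ctr X_geodesic _.
  by move=> g; apply: contrapT => ng; apply: h; exists g.
have [|D D0 ins] := confined_insertion act_isometric finball fproper ctr X_geodesic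
  nc P_confining.
  move=> p Pp.
  apply: (max_finite_normal_core act_isometric finball fproper ctr X_geodesic nc).
  by move=> Ep; have : (P `&` max_finite_normal G) p by []; rewrite P_non_degenerate.2.
(* The length threshold under which deleting an inserted element might fail to shorten a tail. *)
have [W Wfin insW] := ins (6 * D).
have [c c1 growth] := growth_pure.
set omega := fine _ in growth.
have omega0 := growth_gt0 finball c1 growth G_non_elementary.1.
apply/cvgr0Pnorm_le => e e0.
have [N NP] := short_ball_negligible act_isometric finball X_geodesic H_subgroup Wfin insW
  c1 growth omega0 e0.
exists (maxn N 1) => // n /=; rewrite geq_max => /andP[Nn n1].
have b0 : 0 < (card_set (ballG act o n))%:R :> R.
  have /andP[+ _] := growth n n1; apply: lt_le_trans.
  by rewrite mulr_gt0 ?expR_gt0// invr_gt0 (lt_le_trans ltr01).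
rewrite ger0_norm ?divr_ge0// ler_pdivrMr//; apply: le_trans (NP n Nn).
by rewrite ler_nat; exact: card_cosets_le.
Qed.
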